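(* Let $\mathcal{X}=[0,1]^d$ and let $\mathcal{H}$ be the reproducing kernel Hilbert space of the Matérn kernel on $\mathbb{R}^d$, $$k(x,y)=\sigma^{2}\,\frac{2^{1-\nu}}{\Gamma(\nu)}\left(\sqrt{2\nu}\,\frac{\|x-y\|}{\rho}\right)^{\nu}K_{\nu}\left(\sqrt{2\nu}\,\frac{\|x-y\|}{\rho}\right),$$ with parameters $\nu>0$, $\rho>0$ and $0<\sigma^2\le1$. For $R>0$ let $S=\{f\in\mathcal{H}:\|f\|_{\mathcal{H}}\le R\}$. If there exists a deterministic algorithm that achieves simple regret $r_{(T)}\le\epsilon$ for every function $f\in S$ in $T$ function evaluations for the problem $\min_{x\in\mathcal{X}}f(x)$, then it is necessary that $$T=\Omega\left(\left(\frac{R}{\epsilon}\right)^{\frac{d}{\nu+d/2}}\left(\log\frac{R}{\epsilon}\right)^{-1}\right).$$ Furthermore, there exist a deterministic algorithm and $T$ satisfying $$T=\mathcal{O}\left(\left(\frac{R}{\epsilon}\right)^{\frac{d}{\nu}}\right)$$ such that the algorithm achieves $r_{(T)}\le\epsilon$ in $T$ function evaluations for every $f\in S$. Explicitly: there exist constants $c,C>0$ and $\eta_0\in(0,1)$, which may depend on $d,\nu,\rho,\sigma$ but not on $R$, $\epsilon$, $T$ or the algorithm, such that for all $R>0$ and $\epsilon>0$ with $\epsilon/R<\eta_0$: (i) if for some positive integer $T$ a deterministic algorithm has $r_{(T)}\le\epsilon$ for all $f\in S$, then $T\ge c\,(R/\epsilon)^{d/(\nu+d/2)}(\log(R/\epsilon))^{-1}$;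 (ii) there exist a positive integer $T\le C\,(R/\epsilon)^{d/\nu}$ and a deterministic algorithm (which may depend on $R$ and $\epsilon$) with $r_{(T)}\le\epsilon$ for all $f\in S$.
   Context: $\|x-y\|$ is the Euclidean norm on $\mathbb{R}^d$, $\Gamma$ is the gamma function, and $K_\nu$ is the modified Bessel function of the second kind; at $x=y$ the kernel is defined by continuity, $k(x,x)=\sigma^2$. $\mathcal{H}$ consists of functions $\mathbb{R}^d\to\mathbb{R}$ with RKHS norm $\|\cdot\|_{\mathcal{H}}$. Deterministic algorithm: a sequence of mappings $(\pi_t)_{t\ge1}$ with $\pi_1:\{\emptyset\}\to\mathcal{X}$ and $\pi_t:(\mathcal{X}\times\mathbb{R})^{t-1}\to\mathcal{X}$ for $t\ge2$. Run on $f$, it evaluates $f$ (noiselessly) at $x_1=\pi_1(\emptyset)$ and $x_t=\pi_t\big((x_\tau,f(x_\tau))_{\tau=1}^{t-1}\big)$ for $t\ge2$. Simple regret after $t$ evaluations: $r_{(t)}=\min_{1\le\tau\le t}f(x_\tau)-\min_{x\in\mathcal{X}}f(x)$. $\log$ is the natural logarithm. *)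

(* Defs.v *)
From HB Require Import structures.
From mathcomp Require Import all_boot all_order all_algebra.
From mathcomp Require Import all_classical all_reals all_analysis.

Set Implicit Arguments.
Unset Strict Implicit.
Unset Printing Implicit Defensive.

Import Order.TTheory GRing.Theory Num.Theory.
Import numFieldNormedType.Exports.

Local Open Scope classical_set_scope.
Local Open Scope ring_scope.

(** ** Special functions *)

Section special_functions.
Context {R : realType}.
Implicit Types nu z t : R.

(* Euler's integral; meant for [0 < z]. *)
Definition Gamma z : R :=
  \int[@lebesgue_measure R]_(t in `]0, +oo[) (t `^ (z - 1) * expR (- t)).

Definition cosh t : R := (expR t + expR (- t)) / 2.

(* Modified Bessel function of the second kind, by its classical integral
   representation K_nu(z) = int_0^oo exp(- z cosh t) cosh(nu t) dt, which holds
   for every order [nu] (integers included) and every [0 < z]. *)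
Definition besselK nu z : R :=
  \int[@lebesgue_measure R]_(t in `[0, +oo[)
    (expR (- (z * cosh t)) * cosh (nu * t)).

End special_functions.

(** ** Matern kernel *)

Section matern.
Context {R : realType} {d : nat}.

(* The library norm on ['rV[R]_d] is the sup norm, hence this definition. *)
Definition euclidean_norm (x : 'rV[R]_d) : R :=
  Num.sqrt (\sum_(i < d) x ord0 i ^+ 2).

Definition matern (nu rho sigma : R) (x y : 'rV[R]_d) : R :=
  let z := Num.sqrt (2 * nu) * (euclidean_norm (x - y) / rho) in
  if x == y then sigma ^+ 2
  else sigma ^+ 2 * (2 `^ (1 - nu) / Gamma nu) * z `^ nu * besselK nu z.

End matern.

(** ** Reproducing kernel Hilbert spaces *)

Section rkhs.
Context {R : realType} {V : Type}.
Implicit Types (H : set (V -> R)) (ip : (V -> R) -> (V -> R) -> R).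

Definition ip_norm ip (f : V -> R) : R := Num.sqrt (ip f f).

(* [H], with the inner product [ip], is a real Hilbert space of functions on
   [V] under the pointwise operations; the values of [ip] outside of [H] are
   irrelevant. *)
Record is_hilbert_function_space H ip : Prop := {
  hilbert_zero : H (fun=> 0);
  hilbert_lin : forall a f g, H f -> H g -> H (fun x => a * f x + g x);
  hilbert_ip_sym : forall f g, H f -> H g -> ip f g = ip g f;
  hilbert_ip_lin : forall a f g h, H f -> H g -> H h ->
    ip (fun x => a * f x + g x) h = a * ip f h + ip g h;
  hilbert_ip_pos : forall f, H f -> f <> (fun=> 0) -> 0 < ip f f;
  hilbert_complete : forall u : nat -> V -> R,
    (forall n, H (u n)) ->
    (forall e, 0 < e -> exists N, forall m n, (N <= m)%N -> (N <= n)%N ->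
       ip_norm ip (fun x => u m x - u n x) < e) ->
    exists2 g, H g &
      (fun n => ip_norm ip (fun x => u n x - g x)) @ \oo --> (0 : R) }.

(* By the Moore-Aronszajn theorem, a positive semidefinite [k] determines
   [H], and [ip] on [H], uniquely. *)
Record is_rkhs (k : V -> V -> R) H ip : Prop := {
  rkhs_hilbert : is_hilbert_function_space H ip;
  rkhs_kernel : forall y, H (k^~ y);
  rkhs_reproducing : forall f y, H f -> ip f (k^~ y) = f y }.

Definition rkhs_ball H ip (r : R) : set (V -> R) :=
  [set f | H f /\ ip_norm ip f <= r].

End rkhs.

(** ** Deterministic algorithms on the unit cube *)

Section algorithms.
Context {R : realType} {d : nat}.

Definition unit_cube : pred 'rV[R]_d :=
  fun x => [forall i : 'I_d, 0 <= x ord0 i <= 1].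

Definition cube_point : Type := {x : 'rV[R]_d | unit_cube x}.

(* [pi t] chooses the evaluation point of index [t.+1] from the [t] previous
   (point, value) pairs, listed in order. *)
Definition algorithm : Type :=
  forall t : nat, t.-tuple (cube_point * R) -> cube_point.

Fixpoint history (pi : algorithm) (f : 'rV[R]_d -> R) (t : nat) :
    t.-tuple (cube_point * R) :=
  match t return t.-tuple (cube_point * R) with
  | 0%N => [tuple]
  | t'.+1 => let h := history pi f t' in
             let x := pi t' h in [tuple of rcons h (x, f (val x))]
  end.

(* [query pi f t] is the evaluation point of index [t.+1]. *)
Definition query (pi : algorithm) (f : 'rV[R]_d -> R) (t : nat) : 'rV[R]_d :=
  val (pi t (history pi f t)).

(* Meant for [0 < T], so that the default value of the iterated minimum is one
   of its terms. The infimum over the cube is attained for continuous [f]. *)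
Definition simple_regret (pi : algorithm) (f : 'rV[R]_d -> R) (T : nat) : R :=
  \big[Num.min/f (query pi f 0)]_(t < T) f (query pi f t)
  - inf [set f x | x in [set` unit_cube]].

End algorithms.

Arguments cube_point : clear implicits.
Arguments algorithm : clear implicits.

(* Main.v *)
(* The Matern kernel is a mixture of Gaussian kernels: it is proportional to the
   integral over v of exp(nu v - e^v) exp(- a e^(-v) |x - y|^2), where
   a = nu / (2 rho^2). So every quadratic form in the kernel reduces to forms in
   Gaussians.

   Upper bound. Interpolate f, in each cell of side 1/M of the cube, by tensor
   Lagrange interpolation with m > nu nodes per direction. The functional giving
   the error at x kills the polynomials of degree less than m, so its Gaussian
   forms are O((e^(-v) / M^2)^m) by Taylor expansion; integrating over v, its
   dual norm in H is O(M^(-nu)). The algorithm evaluates f at the nodes, then at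
   a near-minimizer of the interpolant.

   Lower bound. For N = n^d > T grid points y_j, some nonzero f = sum_j b_j k_{y_j}
   vanishes at the T points queried on the zero function. The Gaussians with
   e^v of order at most n^(-2) are diagonally dominant on the grid, so
   |f|^2 >= lambda |b|^2 with lambda of order n^(-2 nu). As
   |f|^2 = sum_j b_j f(y_j), some |f(y_j)| is at least |f| sqrt(lambda / N),
   which is of order n^(-(nu + d/2)) |f|. *)

Require Import Defs.
From HB Require Import structures.
From mathcomp Require Import all_boot all_order all_algebra.
From mathcomp Require Import all_classical all_reals all_analysis.
From mathcomp Require Import measurable_realfun exponential_distribution qpoly.
From mathcomp Require Import zify ring lra.

Set Implicit Arguments.
Unset Strict Implicit.
Unset Printing Implicit Defensive.

Import Order.TTheory GRing.Theory Num.Theory.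
Import numFieldNormedType.Exports.

Local Open Scope classical_set_scope.
Local Open Scope ring_scope.

(** * Integrals over the real line *)

Section change_of_variables.
Context {R : realType}.
Local Notation mu := (@lebesgue_measure R).

(** Lebesgue measure is the only measure giving each interval []a, b]] its length, and translation
    preserves lengths. *)
Lemma lebesgue_measure_shift (c : R) (A : set R) : measurable A ->
  pushforward mu (fun x : measurableTypeR R => x + c : measurableTypeR R) A
  = mu A.
Proof.
have ms : measurable_fun setT
    (fun x : measurableTypeR R => x + c : measurableTypeR R).
  exact: measurable_funD.
move=> mA; apply/esym/lebesgue_measure_unique => //= _ [[a b]] _ <-.
rewrite /pushforward.
have -> : (fun x : R => x + c) @^-1` [set` `]a, b]%R] =
    [set` `](a - c), (b - c)]%R].
  by apply/seteqP; split => x /=; rewrite !in_itv/= ltrBlDr lerBrDr.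
rewrite !lebesgue_measure_itv/= !lte_fin ltrD2r.
by case: ifP => // _; rewrite -!EFinB; congr EFin; lra.
Qed.

Lemma ge0_integral_shift (c : R) (f : R -> \bar R) :
  measurable_fun [set: R] f -> (forall x, 0 <= f x)%E ->
  (\int[mu]_x f (x + c)%R = \int[mu]_x f x)%E.
Proof.
move=> mf f0.
have ms : measurable_fun setT
    (fun x : measurableTypeR R => x + c : measurableTypeR R).
  exact: measurable_funD.
transitivity (\int[pushforward mu
    (fun x : measurableTypeR R => (x + c)%R : measurableTypeR R)]_x f x)%E.
  by rewrite (ge0_integral_pushforward ms).
apply: eq_measure_integral => //= A mA _; exact: lebesgue_measure_shift.
Qed.

Lemma ge0_integral_reflect (f : R -> \bar R) :
  measurable_fun [set: R] f -> (forall x, 0 <= f x)%E ->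
  (\int[mu]_x f (- x)%R = \int[mu]_x f x)%E.
Proof.
move=> mf f0.
have ms : measurable_fun setT
  (-%R : measurableTypeR R -> measurableTypeR R) by exact: oppr_measurable.
transitivity (\int[pushforward mu
    (-%R : measurableTypeR R -> measurableTypeR R)]_x f x)%E.
  by rewrite (ge0_integral_pushforward ms).
apply: eq_measure_integral => //= A mA _; exact: lebesgue_measureN.
Qed.

(** Substitution is applied on the compact intervals [B n], whose images under [expR] are the [A n].
    Both families exhaust their domains, so monotone convergence carries the equality to the
    limit. *)
Lemma ge0_integral_expR (G : R -> R) :
  {in `]0, +oo[%R, continuous G} -> (forall x, 0 < x -> 0 <= G x) ->
  (\int[mu]_(x in `]0%R, +oo[) (G x)%:E
   = \int[mu]_u (G (expR u) * expR u)%:E)%E.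
Proof.
move=> cG G0.
have mG : measurable_fun (`]0%R, +oo[%classic : set R) G.
  apply: open_continuous_measurable_fun; first exact: interval_open.
  by move=> x; rewrite inE/= => xI; exact: cG.
have cH : continuous (fun u => G (expR u) * expR u).
  move=> u; apply: continuousM; last exact: continuous_expR.
  apply: continuous_comp; first exact: continuous_expR.
  by apply: cG; rewrite in_itv/= expR_gt0.
pose A n := [set` `[expR (- n%:R) : R, expR n%:R]].
pose B n := [set` `[(- n%:R) : R, n%:R]].
have UA : `]0%R, +oo[%classic = \bigcup_n A n.
  apply/seteqP; split => x /=; rewrite in_itv/= andbT; last first.
    by move=> [n _]; rewrite /A/= in_itv/= => /andP[+ _]; apply/lt_le_trans/expR_gt0.
  move=> x0; exists (Num.truncn `|ln x|).+1 => //; rewrite /A/= in_itv/=.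
  have /ltW := truncnS_gt `|ln x|; set N := _.+1%:R.
  rewrite ler_norml => /andP[h1 h2].
  by apply/andP; split; rewrite -(lnK x0) ler_expR.
have UB : [set: R] = \bigcup_n B n.
  apply/seteqP; split => [x _|//].
  exists (Num.truncn `|x|).+1 => //; rewrite /B/= in_itv/=.
  by have /ltW := truncnS_gt `|x|; rewrite ler_norml.
have leR (m n : nat) : (m <= n)%N -> (m%:R <= n%:R :> R) by rewrite ler_nat.
have ndA : nondecreasing_seq A.
  move=> m n /leR mn; rewrite subsetEset /A => x /=.
  rewrite !in_itv/= => /andP[h1 h2]; apply/andP; split.
    by apply: le_trans h1; rewrite ler_expR lerN2.
  by apply: (le_trans h2); rewrite ler_expR.
have ndB : nondecreasing_seq B.
  move=> m n /leR mn; rewrite subsetEset /B => x /=.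
  rewrite !in_itv/= => /andP[h1 h2]; apply/andP; split; lra.
have sA n : A n `<=` `]0, +oo[%classic.
  by rewrite UA; exact: bigcup_sup.
have hA : ((\int[mu]_(x in A n) (G x)%:E)%E @[n --> \oo] -->
    (\int[mu]_(x in \bigcup_n A n) (G x)%:E)%E)%classic.
  apply: ge0_nondecreasing_set_cvg_integral => //.
  - by move=> i; exact: measurable_itv.
  - move=> i; apply/measurable_EFinP; exact: measurable_funS mG.
  - by move=> i x /sA/=; rewrite in_itv/= andbT => /G0; rewrite lee_fin.
have hB : ((\int[mu]_(u in B n) (G (expR u) * expR u)%:E)%E @[n --> \oo] -->
    (\int[mu]_(u in \bigcup_n B n) (G (expR u) * expR u)%:E)%E)%classic.
  apply: ge0_nondecreasing_set_cvg_integral => //.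
  - by move=> i; exact: measurable_itv.
  - move=> i; apply/measurable_EFinP; apply: measurable_funTS.
    exact: continuous_measurable_fun.
  - by move=> i x _; rewrite lee_fin mulr_ge0 ?expR_ge0// G0 ?expR_gt0.
rewrite UA UB -(cvg_lim _ hA)// -(cvg_lim _ hB)//; congr (limn _).
apply/funext => n; rewrite /A /B.
have dE : ((expR : R -> R)^`()%classic = expR).
  by apply/funext => x; rewrite derive1E; have /funeqP -> := @derive_expR R.
  rewrite integration_by_substitution_increasing ?dE//.
  - by apply: (@le_trans _ _ 0); rewrite ?oppr_le0.
  - by move=> x y _ _; rewrite ltr_expR.
  - by move=> x _; exact: continuous_expR.
  - by apply/cvg_ex; eexists; apply: cvg_at_right_filter; exact: continuous_expR.
  - by apply/cvg_ex; eexists; apply: cvg_at_left_filter; exact: continuous_expR.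
  - split.
    + by move=> x _; exact: derivable_expR.
    + by apply: cvg_at_right_filter; exact: continuous_expR.
    + by apply: cvg_at_left_filter; exact: continuous_expR.
  - apply: continuous_in_subspaceT => x; rewrite inE/= => xI.
    by apply: cG; exact: (sA n).
Qed.

End change_of_variables.

(** * Quadratic forms of a kernel *)

Section kernel_forms.
Context {R : realType} {V : Type} {I : Type}.
Implicit Types (K : V -> V -> R) (s : seq I) (b : I -> R) (y : I -> V).

(** For a reproducing kernel, this is the squared norm of [\sum_i b i * K x (y i)] as a function of
    [x], hence of the functional sending [f] to [\sum_i b i * f (y i)]. *)
Definition kernel_form K s b y : R :=
  \sum_(i <- s) \sum_(j <- s) b i * b j * K (y i) (y j).

Lemma kernel_form_lin (a : R) K K' s b y :
  kernel_form (fun u v => a * K u v + K' u v) s b y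
  = a * kernel_form K s b y + kernel_form K' s b y.
Proof.
rewrite /kernel_form big_distrr -big_split/=; apply: eq_bigr => i _.
rewrite big_distrr -big_split/=; apply: eq_bigr => j _; ring.
Qed.

Lemma kernel_form0 s b y : kernel_form (fun _ _ => 0) s b y = 0.
Proof. by rewrite /kernel_form big1// => i _; rewrite big1// => j _; rewrite mulr0. Qed.

Lemma kernel_form_sum (J : Type) (t : seq J) (P : pred J)
    (K : J -> V -> V -> R) s b y :
  kernel_form (fun u v => \sum_(k <- t | P k) K k u v) s b y
  = \sum_(k <- t | P k) kernel_form (K k) s b y.
Proof.
rewrite exchange_big/=; apply: eq_bigr => i _.
rewrite exchange_big/=; apply: eq_bigr => j _.
by rewrite big_distrr.
Qed.

Lemma kernel_form_weight (g : V -> R) K s b y :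
  kernel_form (fun u v => g u * g v * K u v) s b y
  = kernel_form K s (fun i => b i * g (y i)) y.
Proof. by apply: eq_bigr => i _; apply: eq_bigr => j _; ring. Qed.

Lemma eq_kernel_form K K' s b y : (forall u v, K u v = K' u v) ->
  kernel_form K s b y = kernel_form K' s b y.
Proof. by move=> E; apply: eq_bigr => i _; apply: eq_bigr => j _; rewrite E. Qed.

Lemma kernel_form_bound K s b y (B : R) :
  (forall i j, `|K (y i) (y j)| <= B) ->
  `|kernel_form K s b y| <= (\sum_(i <- s) `|b i|) ^+ 2 * B.
Proof.
move=> hB; rewrite /kernel_form expr2 big_distrlr/= big_distrl/=.
apply: le_trans (ler_norm_sum _ _ _) _; apply: ler_sum => i _.
rewrite big_distrl/=.
apply: le_trans (ler_norm_sum _ _ _) _; apply: ler_sum => j _.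
by rewrite !normrM ler_wpM2l// mulr_ge0.
Qed.

Lemma kernel_form_cvg (K_ : nat -> V -> V -> R) K s b y :
  (forall u v, K_ n u v @[n --> \oo] --> K u v) ->
  kernel_form (K_ n) s b y @[n --> \oo] --> kernel_form K s b y.
Proof.
move=> cK; rewrite /kernel_form.
apply: cvg_big => [|i _]; first exact: add_continuous.
apply: cvg_big => [|j _]; first exact: add_continuous.
by apply: cvgMr; exact: cK.
Qed.

End kernel_forms.

(** * Hilbert function spaces *)

Section hilbert.
Context {R : realType} {V : Type}.
Variables (H : set (V -> R)) (ip : (V -> R) -> (V -> R) -> R).
Hypothesis hH : is_hilbert_function_space H ip.

Lemma ip0l f : H f -> ip (fun=> 0) f = 0.
Proof.
move=> Hf; have H0 := hilbert_zero hH.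
have := hilbert_ip_lin hH 1 H0 H0 Hf.
have -> : (fun x : V => 1 * (fun=> 0 : R) x + (fun=> 0 : R) x) = fun=> 0.
  by apply/funext => x; rewrite mulr0 addr0.
by rewrite mul1r => /eqP; rewrite -subr_eq subrr eq_sym => /eqP.
Qed.

Lemma ip_ge0 f : H f -> 0 <= ip f f.
Proof.
move=> Hf; have [->|f0] := pselect (f = fun=> 0).
  by rewrite ip0l//; exact: (hilbert_zero hH).
exact/ltW/(hilbert_ip_pos hH).
Qed.

Lemma hilbert_scale a f : H f -> H (fun x => a * f x).
Proof.
move=> Hf; have := hilbert_lin hH a Hf (hilbert_zero hH).
by under eq_fun do rewrite addr0.
Qed.

Lemma ip_scalel a f g : H f -> H g -> ip (fun x => a * f x) g = a * ip f g.
Proof.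
move=> Hf Hg; have := hilbert_ip_lin hH a Hf (hilbert_zero hH) Hg.
by rewrite ip0l// addr0; under eq_fun do rewrite addr0.
Qed.

Lemma ip_scale a f : H f -> ip (fun x => a * f x) (fun x => a * f x) = a ^+ 2 * ip f f.
Proof.
move=> Hf; rewrite ip_scalel//; last exact: hilbert_scale.
rewrite (hilbert_ip_sym hH Hf (hilbert_scale a Hf)) ip_scalel//.
by rewrite mulrA expr2.
Qed.

Lemma ip_cauchy_schwarz f g : H f -> H g -> ip f g ^+ 2 <= ip f f * ip g g.
Proof.
move=> Hf Hg; have Hgg := ip_ge0 Hg.
have [->|g0] := pselect (g = fun=> 0).
  by rewrite (hilbert_ip_sym hH Hf (hilbert_zero hH)) !ip0l//
    ?expr0n/= ?mulr0//; exact: (hilbert_zero hH).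
have gg0 : 0 < ip g g by exact: (hilbert_ip_pos hH).
(* This [t] minimizes the squared norm of [t * g + f]; nonnegativity of the minimum is the
   inequality. *)
pose t := - ip f g / ip g g.
have Hh := hilbert_lin hH t Hg Hf.
have := ip_ge0 Hh.
rewrite (hilbert_ip_lin hH t Hg Hf Hh).
rewrite (hilbert_ip_sym hH Hg Hh) (hilbert_ip_sym hH Hf Hh).
rewrite !(hilbert_ip_lin hH t Hg Hf) // (hilbert_ip_sym hH Hg Hf) => h.
have E : t * ip g g = - ip f g by rewrite /t divfK// gt_eqF.
rewrite -subr_ge0.
have : 0 <= ip g g * (t * (t * ip g g + ip f g) + (t * ip f g + ip f f)).
  exact: mulr_ge0.
rewrite E addNr mulr0 add0r mulrDr mulrA [ip g g * t]mulrC E.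
by rewrite mulNr -expr2 addrC [ip g g * _]mulrC.
Qed.

Section finite_combinations.
Context {I : Type}.
Implicit Types (s : seq I) (b : I -> R) (k : I -> V -> R).

Lemma hilbert_sum s b k : (forall i, H (k i)) ->
  H (fun x => \sum_(i <- s) b i * k i x).
Proof.
move=> Hk; elim: s => [|i s ih].
  by under eq_fun do rewrite big_nil; exact: (hilbert_zero hH).
under eq_fun do rewrite big_cons.
exact: (hilbert_lin hH).
Qed.

Lemma ip_suml s b k f : (forall i, H (k i)) -> H f ->
  ip (fun x => \sum_(i <- s) b i * k i x) f = \sum_(i <- s) b i * ip (k i) f.
Proof.
move=> Hk Hf; elim: s => [|i s ih].
  by rewrite big_nil; under eq_fun do rewrite big_nil; exact: ip0l.
rewrite big_cons -ih; under eq_fun do rewrite big_cons.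
by rewrite (hilbert_ip_lin hH)//; exact: hilbert_sum.
Qed.

End finite_combinations.
End hilbert.

Section rkhs_theory.
Context {R : realType} {V : Type}.
Variables (k : V -> V -> R) (H : set (V -> R)).
Variables (ip : (V -> R) -> (V -> R) -> R).
Hypothesis hk : is_rkhs k H ip.
Let hH := rkhs_hilbert hk.

Lemma ip_kernel_sum {I : Type} (s : seq I) (b : I -> R) (y : I -> V) f : H f ->
  ip f (fun x => \sum_(i <- s) b i * k x (y i)) = \sum_(i <- s) b i * f (y i).
Proof.
move=> Hf; have Hk i : H (k^~ (y i)) by exact: (rkhs_kernel hk).
rewrite (hilbert_ip_sym hH Hf); last exact: (hilbert_sum hH).
rewrite (ip_suml hH)//; apply: eq_bigr => i _.
by rewrite (hilbert_ip_sym hH)// (rkhs_reproducing hk).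
Qed.

Lemma kernel_sum_rkhs {I : Type} (s : seq I) (b : I -> R) (y : I -> V) :
  H (fun x => \sum_(i <- s) b i * k x (y i)).
Proof. by apply: (hilbert_sum hH) => i; exact: (rkhs_kernel hk). Qed.

Lemma ip_kernel_form {I : Type} (s : seq I) (b : I -> R) (y : I -> V) :
  let f := fun x => \sum_(i <- s) b i * k x (y i) in
  ip f f = kernel_form k s b y.
Proof.
move=> f; rewrite ip_kernel_sum; last exact: kernel_sum_rkhs.
apply: eq_bigr => i _; rewrite /f big_distrr/=.
by apply: eq_bigr => j _; rewrite mulrA.
Qed.

(** By the reproducing property the sum is the inner product of [f] with a combination of kernels,
    whose squared norm is the form; Cauchy-Schwarz concludes. *)
Lemma rkhs_functional_bound {I : Type} (s : seq I) (b : I -> R) (y : I -> V) f :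
  H f ->
  `|\sum_(i <- s) b i * f (y i)|
    <= ip_norm ip f * Num.sqrt (kernel_form k s b y).
Proof.
move=> Hf; rewrite -ip_kernel_sum// /ip_norm.
rewrite -sqrtrM; last exact: (ip_ge0 hH).
rewrite -sqrtr_sqr ler_wsqrtr//.
rewrite -ip_kernel_form; apply: (ip_cauchy_schwarz hH) => //.
exact: kernel_sum_rkhs.
Qed.

End rkhs_theory.

(** * Gaussian kernels *)

Section exponential_taylor.
Context {R : realType}.
Implicit Types u : R.

Lemma cvg_expR_series u : (\sum_(n < N) u ^+ n / n`!%:R) @[N --> \oo] --> expR u.
Proof.
have cu : series (exp_coeff u) @ \oo --> expR u.
  exact: is_cvg_series_exp_coeff.
rewrite (_ : (fun N => _) = series (exp_coeff u))//.
by apply/funext => N; rewrite /series/= big_mkord.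
Qed.

Lemma expR_series_le u N : 0 <= u -> \sum_(n < N) u ^+ n / n`!%:R <= expR u.
Proof.
move=> u0; have := @cvg_expR_series u.
set S := (fun N : nat => _ : R) => cS.
have ndS : nondecreasing_seq S.
  apply/nondecreasing_seqP => n; rewrite /S big_ord_recr/= lerDl.
  by rewrite divr_ge0// exprn_ge0.
rewrite -(cvg_lim _ cS)//; apply: (nondecreasing_cvgn_le ndS).
by apply/cvg_ex; exists (expR u).
Qed.

(** In the tail, [(m + n)!] is at least [n!], so [u ^+ m] factors out and what remains is bounded by
    the series of [expR u]. *)
Lemma expR_taylor u m : 0 <= u ->
  `|expR (- u) - \sum_(n < m) (- u) ^+ n / n`!%:R| <= u ^+ m * expR u.
Proof.
move=> u0; have := @cvg_expR_series (- u).
set S := (fun N : nat => _ : R) => cS.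
have cD : `|S N - S m| @[N --> \oo] --> `|expR (- u) - S m|.
  by apply: cvg_norm; apply: cvgB => //; exact: cvg_cst.
rewrite -/(S m) -(cvg_lim _ cD)//; apply: limr_le.
  by apply/cvg_ex; eexists; exact: cD.
near=> N.
have mN : (m <= N)%N by near: N; exact: nbhs_infty_ge.
rewrite /S -(subnKC mN) big_split_ord/= addrAC subrr add0r.
apply: le_trans (ler_norm_sum _ _ _) _.
apply: (@le_trans _ _ (u ^+ m * \sum_(n < N - m) u ^+ n / n`!%:R)); last first.
  by rewrite ler_wpM2l ?exprn_ge0// expR_series_le.
rewrite big_distrr/=; apply: ler_sum => n _.
rewrite normrM normrX normrN (ger0_norm u0) exprD -mulrA.
rewrite ler_wpM2l ?exprn_ge0// ler_wpM2l ?exprn_ge0//.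
rewrite ger0_norm ?invr_ge0// lef_pV2 ?posrE ?ltr0n ?fact_gt0// ler_nat.
by rewrite leq_fact// leq_addl.
Unshelve. all: by end_near. Qed.

End exponential_taylor.

Section gaussian.
Context {R : realType} {d : nat}.
Implicit Types (x y : 'rV[R]_d).

Definition dist2 x y : R := \sum_(k < d) (x ord0 k - y ord0 k) ^+ 2.

Definition gauss (s : R) x y : R := expR (- (s * dist2 x y)).

Definition dot x y : R := \sum_(k < d) x ord0 k * y ord0 k.

Lemma dist2_ge0 x y : 0 <= dist2 x y.
Proof. by apply: sumr_ge0 => k _; exact: sqr_ge0. Qed.

Lemma dist2C x y : dist2 x y = dist2 y x.
Proof. by apply: eq_bigr => k _; rewrite -sqrrN opprB. Qed.

Lemma dist2E x y : dist2 x y = dot x x + dot y y - 2 * dot x y.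
Proof.
rewrite /dot /dist2 big_distrr/= -big_split/= -sumrB.
by apply: eq_bigr => k _; ring.
Qed.

Section forms.
Context {I : Type}.
Implicit Types (r : seq I) (b : I -> R) (p : I -> 'rV[R]_d).

(** Expanding one factor [dot x y] over the coordinates, the product of the two [k]-th coordinates
    is absorbed into the coefficients, leaving a sum of forms of lower power. The form of power 0 is
    a square. *)
Lemma dotX_form_ge0 n r b p : 0 <= kernel_form (fun x y => dot x y ^+ n) r b p.
Proof.
elim: n b => [|n ih] b.
  rewrite /kernel_form.
  have -> : \sum_(i <- r) \sum_(j <- r) b i * b j * dot (p i) (p j) ^+ 0
      = (\sum_(i <- r) b i) ^+ 2.
    rewrite expr2 big_distrlr/=; apply: eq_bigr => i _; apply: eq_bigr => j _.
    by rewrite expr0 mulr1.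
  exact: sqr_ge0.
have -> : kernel_form (fun x y => dot x y ^+ n.+1) r b p
   = \sum_(k < d) kernel_form (fun x y => dot x y ^+ n) r
       (fun i => b i * p i ord0 k) p.
  transitivity (kernel_form (fun x y =>
     \sum_(k < d) x ord0 k * y ord0 k * dot x y ^+ n) r b p).
    by apply: eq_kernel_form => x y; rewrite exprS {1}/dot big_distrl.
  rewrite kernel_form_sum; apply: eq_bigr => k _.
  exact: (kernel_form_weight (fun x : 'rV[R]_d => x ord0 k)).
by apply: sumr_ge0.
Qed.

(* Up to the weights [expR (- s |x|^2)], the Gaussian kernel is the sum of the
   power series of [expR (2 s <x, y>)]. *)
Lemma gauss_form_ge0 s r b p : 0 <= s -> 0 <= kernel_form (gauss s) r b p.
Proof.
move=> s0.
have -> : kernel_form (gauss s) r b p =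
    kernel_form (fun x y => expR (2 * s * dot x y)) r
      (fun i => b i * expR (- (s * dot (p i) (p i)))) p.
  rewrite -(kernel_form_weight (fun x => expR (- (s * dot x x)))).
  apply: eq_kernel_form => x y; rewrite -!expRD /gauss dist2E.
  by congr expR; ring.
set c := (fun i : I => _).
have := @kernel_form_cvg R _ _
  (fun N x y => \sum_(n < N) (2 * s * dot x y) ^+ n / n`!%:R) _ r c p
  (fun x y => @cvg_expR_series R (2 * s * dot x y)).
move=> cv; rewrite -(cvg_lim _ cv)//; apply: limr_ge.
  by apply/cvg_ex; eexists; exact: cv.
apply: nearW => N; rewrite kernel_form_sum; apply: sumr_ge0 => n _.
have -> : kernel_form (fun x y => (2 * s * dot x y) ^+ n / n`!%:R) r c p
  = (2 * s) ^+ n / n`!%:R * kernel_form (fun x y => dot x y ^+ n) r c p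
    + kernel_form (fun _ _ => 0) r c p.
  rewrite -kernel_form_lin; apply: eq_kernel_form => x y.
  by rewrite addr0 exprMn; ring.
rewrite kernel_form0 addr0 mulr_ge0 ?dotX_form_ge0// divr_ge0// exprn_ge0//.
by rewrite mulr_ge0.
Qed.

(** A list of coordinates serves as multi-index: the degree is its size, and multiplying by a
    coordinate is a cons. *)
Definition monomial (u : seq 'I_d) x : R := \prod_(k <- u) x ord0 k.

Definition annihilates m r b p := forall u : seq 'I_d,
  (size u < m)%N -> \sum_(i <- r) b i * monomial u (p i) = 0.

(* Every monomial of the expansion of the kernel has degree less than [m] in
   one of its two arguments. *)
Lemma annihilates_dist2X m r b p n (u v : seq 'I_d) : annihilates m r b p ->
  (size u + size v + n.*2 < m.*2)%N ->
  kernel_form (fun x y => monomial u x * monomial v y * dist2 x y ^+ n) r b p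
  = 0.
Proof.
move=> ann; elim: n u v => [|n ih] u v huv.
  have -> : kernel_form
      (fun x y => monomial u x * monomial v y * dist2 x y ^+ 0) r b p
    = (\sum_(i <- r) b i * monomial u (p i)) *
      (\sum_(i <- r) b i * monomial v (p i)).
    rewrite big_distrlr/=; apply: eq_bigr => i _; apply: eq_bigr => j _.
    by rewrite expr0; ring.
  have [um|um] := ltnP (size u) m; first by rewrite ann// mul0r.
  by rewrite mulrC ann ?mul0r//; move: huv; lia.
have -> : kernel_form
    (fun x y => monomial u x * monomial v y * dist2 x y ^+ n.+1) r b p
  = \sum_(k < d)
     (kernel_form (fun x y => monomial [:: k, k & u] x * monomial v y
        * dist2 x y ^+ n) r b p
      + (- 2 * kernel_form (fun x y => monomial (k :: u) x
           * monomial (k :: v) y * dist2 x y ^+ n) r b p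
      + kernel_form (fun x y => monomial u x * monomial [:: k, k & v] y
        * dist2 x y ^+ n) r b p)).
  transitivity (\sum_(k < d) kernel_form (fun x y =>
     1 * (monomial [:: k, k & u] x * monomial v y * dist2 x y ^+ n) +
     (- 2 * (monomial (k :: u) x * monomial (k :: v) y * dist2 x y ^+ n) +
      monomial u x * monomial [:: k, k & v] y * dist2 x y ^+ n)) r b p).
    rewrite -kernel_form_sum; apply: eq_kernel_form => x y.
    rewrite exprS {1}/dist2 mulrA big_distrr/= big_distrl/=.
    by apply: eq_bigr => k _; rewrite /monomial !big_cons; ring.
  by apply: eq_bigr => k _; rewrite !kernel_form_lin mul1r.
rewrite big1// => k _; rewrite !ih/= ?mulr0 ?addr0//; lia.
Qed.

Lemma gauss_form_bound s r b p : 0 <= s ->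
  `|kernel_form (gauss s) r b p| <= (\sum_(i <- r) `|b i|) ^+ 2.
Proof.
move=> s0; rewrite -[leRHS]mulr1; apply: kernel_form_bound => i j.
by rewrite ger0_norm ?expR_ge0// expR_le1 oppr_le0 mulr_ge0// dist2_ge0.
Qed.

(** The Taylor polynomial [T] of the Gaussian, of degree less than [m] in [dist2], has zero form by
    [annihilates_dist2X]. Only the remainder counts, and [expR_taylor] bounds it entrywise. *)
Lemma gauss_form_small m s D r b p : 0 <= s -> annihilates m r b p ->
  (forall i j, dist2 (p i) (p j) <= D) -> s * D <= 1 ->
  `|kernel_form (gauss s) r b p|
    <= (\sum_(i <- r) `|b i|) ^+ 2 * (expR 1 * (s * D) ^+ m).
Proof.
move=> s0 ann hD sD.
pose T x y := \sum_(n < m) (- (s * dist2 x y)) ^+ n / n`!%:R.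
have T0 : kernel_form T r b p = 0.
  rewrite kernel_form_sum big1// => n _.
  transitivity (kernel_form (fun x y => (- s) ^+ n / n`!%:R *
    (monomial [::] x * monomial [::] y * dist2 x y ^+ n) + 0) r b p).
    apply: eq_kernel_form => x y; rewrite /monomial !big_nil.
    by rewrite -mulNr exprMn; ring.
  by rewrite kernel_form_lin kernel_form0 (annihilates_dist2X ann)/= ?mulr0
    ?addr0// add0n ltn_double.
have -> : kernel_form (gauss s) r b p =
    kernel_form (fun x y => - 1 * T x y + gauss s x y) r b p.
  by rewrite kernel_form_lin T0 mulr0 add0r.
apply: kernel_form_bound => i j; rewrite mulN1r addrC.
have u0 : 0 <= s * dist2 (p i) (p j) by rewrite mulr_ge0// dist2_ge0.
have uD : s * dist2 (p i) (p j) <= s * D by rewrite ler_wpM2l.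
apply: le_trans (expR_taylor m u0) _; rewrite mulrC.
apply: ler_pM; rewrite ?expR_ge0 ?exprn_ge0//.
  by rewrite ler_expR (le_trans uD).
by rewrite lerXn2r// nnegrE (le_trans u0).
Qed.

End forms.

End gaussian.

(** * Diagonally dominant forms *)

Section diagonal_dominance.
Context {R : realType} {V : Type} {I : finType}.

(** Each off-diagonal term is at least [- A i j], because [2 * b i * b j] is at least
    [- (b i ^+ 2 + b j ^+ 2)]. By symmetry of [K] the two halves of [A] have the same sum,
    controlled by the row sums. *)
Lemma kernel_form_diag_dominant (K : V -> V -> R) (b : I -> R) (y : I -> V) S :
  (forall u v, K u v = K v u) -> (forall u v, 0 <= K u v) ->
  (forall u, K u u = 1) ->
  (forall i, \sum_(j | j != i) K (y i) (y j) <= S) ->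
  (1 - S) * \sum_i b i ^+ 2 <= kernel_form K (index_enum I) b y.
Proof.
move=> KC K0 K1 KS.
pose A i j := (b i ^+ 2 + b j ^+ 2) / 2 * K (y i) (y j).
have AS : \sum_i \sum_(j | j != i) A i j <= S * \sum_i b i ^+ 2.
  have -> : \sum_i \sum_(j | j != i) A i j =
      \sum_i \sum_(j | j != i) b i ^+ 2 * K (y i) (y j).
    transitivity (\sum_i \sum_(j | j != i) b i ^+ 2 / 2 * K (y i) (y j)
      + \sum_i \sum_(j | j != i) b j ^+ 2 / 2 * K (y i) (y j)).
      rewrite -big_split/=; apply: eq_bigr => i _.
      by rewrite -big_split/=; apply: eq_bigr => j _; rewrite /A; ring.
    have -> : \sum_i \sum_(j | j != i) b j ^+ 2 / 2 * K (y i) (y j) =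
        \sum_i \sum_(j | j != i) b i ^+ 2 / 2 * K (y i) (y j).
      rewrite (exchange_big_dep predT)//=; apply: eq_bigr => i _.
      by apply: eq_big => j; [rewrite eq_sym | rewrite KC].
    rewrite -big_split/=; apply: eq_bigr => i _.
    by rewrite -big_split/=; apply: eq_bigr => j _; field.
  rewrite big_distrr/=; apply: ler_sum => i _.
  rewrite -big_distrr/= [leRHS]mulrC ler_wpM2l ?sqr_ge0//.
rewrite mulrBl mul1r lerBlDr; apply: le_trans (lerD (lexx _) AS).
rewrite /kernel_form -big_split/=; apply: ler_sum => i _.
rewrite (bigD1 i)//= K1 mulr1 -expr2 -addrA lerDl -big_split/=.
apply: sumr_ge0 => j _; rewrite /A -mulrDl mulr_ge0//.
have := sqr_ge0 (b i + b j); rewrite sqrrD; lra.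
Qed.

End diagonal_dominance.

(** * Gaussian kernels on a regular grid *)

Section grid.
Context {R : realType}.

Lemma geometric_sum_le (q : R) N : 0 <= q <= 1 / 2 ->
  \sum_(i < N) q ^+ i <= 1 + 2 * q.
Proof.
move=> q01; elim: N => [|N ih]; first by rewrite big_ord0; lra.
rewrite big_ord_recl expr0.
under eq_bigr do rewrite /bump/= exprS; rewrite -big_distrr/=; nra.
Qed.

Lemma two_sided_geometric_sum_le (q : R) n j : 0 <= q <= 1 / 2 ->
  \sum_(k < n) q ^+ `|j%:Z - k%:Z| <= 1 + 4 * q.
Proof.
move=> q01; have q0 : 0 <= q by lra.
(* The terms with [k >= j] account for [1 + 2 * q], those with [k < j] for the last sum. In the
   induction, removing [k = 0] shifts [j] and [n] down together. *)
suff : \sum_(k < n) q ^+ `|j%:Z - k%:Z| <= 1 + 2 * q + q * \sum_(i < j) q ^+ i.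
  have := geometric_sum_le j q01; nra.
elim: j n => [|j ih] n.
  rewrite big_ord0 mulr0 addr0; under eq_bigr do rewrite sub0r abszN absz_nat.
  exact: geometric_sum_le.
case: n => [|n].
  rewrite big_ord0 addr_ge0//; first lra.
  by rewrite mulr_ge0// sumr_ge0// => i _; rewrite exprn_ge0.
rewrite big_ord_recl; have -> : `|j.+1%:Z - (@ord0 n)%:Z|%N = j.+1.
  by rewrite subr0 absz_nat.
rewrite big_ord_recr/= mulrDr -exprS addrA addrC.
rewrite lerD2l; apply: le_trans (ih n); apply: ler_sum => k _.
rewrite /bump/= -!natz; have -> : (j.+1%:R - (1 + k)%:R = j%:R - k%:R :> int).
  by rewrite -natr1 addrC natrD; ring.
by [].
Qed.

(** The right side is the chord over [[0, 1]] of a convex function. *)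
Lemma expr1D_le (x : R) d : 0 <= x <= 1 -> (1 + x) ^+ d <= 1 + (2 ^+ d - 1) * x.
Proof.
move=> x01; elim: d => [|d ih]; first by rewrite !expr0; lra.
rewrite !exprS; have A1 : 1 <= 2 ^+ d :> R by rewrite exprn_ege1// ler1n.
apply: (@le_trans _ _ ((1 + x) * (1 + (2 ^+ d - 1) * x))).
  by rewrite ler_wpM2l//; lra.
have : 0 <= (2 ^+ d - 1) * (x * (1 - x)).
  by apply: mulr_ge0; [lra | apply: mulr_ge0; lra].
lra.
Qed.

Context {d : nat}.

Definition grid_point n (j : {ffun 'I_d -> 'I_n}) : 'rV[R]_d :=
  \row_k ((j k)%:R / n%:R).

Lemma unit_cube_grid_point n (j : {ffun 'I_d -> 'I_n}) :
  unit_cube (grid_point j).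
Proof.
apply/forallP => k; rewrite mxE; have jn := ltn_ord (j k).
have n0 : (0 < n)%N by exact: leq_trans jn.
by rewrite divr_ge0//= ler_pdivrMr ?ltr0n// mul1r ler_nat ltnW.
Qed.

(** Here [q] bounds the Gaussian of two adjacent grid points. At distance [z] steps in one
    coordinate the factor is at most [q ^+ (z * z)], hence at most [q ^+ z]. The Gaussian factors
    over coordinates, so the full sum is at most [(1 + 4 * q) ^+ d], and the chord bound brings this
    below [1 + 1 / 2], the 1 being the diagonal term. *)
Lemma gauss_grid_off_diag n (j : {ffun 'I_d -> 'I_n}) (s q : R) :
  0 <= s -> 0 <= q -> 4 * q * 2 ^+ d <= 1 / 2 -> expR (- (s / n%:R ^+ 2)) <= q ->
  \sum_(k | k != j) gauss s (grid_point j) (grid_point k) <= 1 / 2.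
Proof.
move=> s0 q0 qd sq.
have d1 : 1 <= 2 ^+ d :> R by rewrite exprn_ege1// ler1n.
have q12 : 4 * q <= 1 / 2 by nra.
suff : \sum_(k : {ffun 'I_d -> 'I_n}) gauss s (grid_point j) (grid_point k)
    <= (1 + 4 * q) ^+ d.
  have -> : \sum_(k : {ffun 'I_d -> 'I_n}) gauss s (grid_point j) (grid_point k) =
      1 + \sum_(k | k != j) gauss s (grid_point j) (grid_point k).
    rewrite [LHS](bigD1 j)//=; congr (_ + _); rewrite /gauss /dist2 big1 => [|i _].
      by rewrite mulr0 oppr0 expR0.
    by rewrite subrr expr0n.
  have := @expr1D_le (4 * q) d; set X := _ ^+ d; set Y := \sum_(_ | _) _.
  by move=> /(_ ltac:(lra)); nra.
have -> : (1 + 4 * q) ^+ d = \prod_(i < d) (1 + 4 * q).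
  by rewrite prodr_const card_ord.
apply: le_trans (_ : \prod_(i < d) \sum_(k < n) q ^+ `|(j i)%:Z - k%:Z| <= _).
  rewrite bigA_distr_bigA/=; apply: ler_sum => k _.
  rewrite /gauss /dist2 big_distrr/= -sumrN expR_sum.
  apply: ler_prod => i _; rewrite expR_ge0/= !mxE.
  set z := `|_|%N.
  have -> : - (s * ((j i)%:R / n%:R - (k i)%:R / n%:R) ^+ 2)
     = (z * z)%:R * (- (s / n%:R ^+ 2)) :> R.
    have -> : (z * z)%:R = ((j i)%:R - (k i)%:R) ^+ 2 :> R.
      rewrite natrM /z -expr2 -[in RHS]real_normK ?num_real//.
      by rewrite natr_absz intr_norm rmorphB.
    by rewrite -mulrBl exprMn exprVn; ring.
  rewrite expRM_natl.
  apply: (@le_trans _ _ (q ^+ (z * z))); first by rewrite lerXn2r// ?nnegrE ?expR_ge0.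
  by apply: ler_wiXn2l => //; [lra | case: (z) => // m; rewrite leq_pmulr].
apply: ler_prod => i _; rewrite sumr_ge0/=; last by move=> k _; rewrite exprn_ge0.
by apply: two_sided_geometric_sum_le; lra.
Qed.

End grid.

(** * The Matern kernel *)

Section gaussian_mixture.
Context {R : realType}.
Local Notation mu := (@lebesgue_measure R).
Implicit Types nu D v z : R.

Definition laplace (b c v : R) : R := expR (- (b * `|v - c|)).

Lemma measurable_laplace b c : measurable_fun [set: R] (laplace b c).
Proof.
apply: measurableT_comp => //; apply: measurable_funN.
apply: measurable_funM => //; apply: measurableT_comp => //.
exact: measurable_funB.
Qed.

(** Up to the factor [b^-1], the integrand lies below the sum of an exponential density started at
    [c] and its mirror image, each of integral 1. *)
Lemma integral_laplace_le b c : 0 < b ->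
  (\int[mu]_v (laplace b c v)%:E <= (2 / b)%:E)%E.
Proof.
move=> b0; have b0' := ltW b0.
pose p := exponential_pdf b.
have p0 v : 0 <= p v by exact: exponential_pdf_ge0.
have mp : measurable_fun [set: R] p by exact: measurable_exponential_pdf.
have mpN : measurable_fun [set: R] (p \o -%R) by exact: measurableT_comp.
have msh : measurable_fun [set: R] (fun v : R => v - c) by exact: measurable_funB.
have E1 : (\int[mu]_v (p (v - c))%:E = 1)%E.
  rewrite (ge0_integral_shift (- c) (f := EFin \o p))//=.
  - exact: integral_exponential_pdf.
  - exact/measurable_EFinP.
have E2 : (\int[mu]_v (p (- (v - c)))%:E = 1)%E.
  rewrite (ge0_integral_shift (- c) (f := EFin \o (p \o -%R)))//=.
  - rewrite (ge0_integral_reflect (f := EFin \o p))//=.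
      exact: integral_exponential_pdf.
    exact/measurable_EFinP.
  - exact/measurable_EFinP.
  - by move=> x; rewrite lee_fin; exact: p0.
have mE1 : measurable_fun [set: R] (fun v => (b^-1 * p (v - c))%:E).
  by apply/measurable_EFinP/measurable_funM => //; exact: measurableT_comp.
have mE2 : measurable_fun [set: R] (fun v => (b^-1 * p (- (v - c)))%:E).
  by apply/measurable_EFinP/measurable_funM => //; exact: (measurableT_comp mpN).
apply: (@le_trans _ _
  (\int[mu]_v ((b^-1 * p (v - c))%:E + (b^-1 * p (- (v - c)))%:E))%E).
  apply: ge0_le_integral => //=.
  - by move=> v _; rewrite lee_fin expR_ge0.
  - by apply/measurable_EFinP; exact: measurable_laplace.
  - exact: emeasurable_funD.
  - move=> v _; rewrite -EFinD lee_fin /laplace.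
    have bV0 : 0 <= b^-1 by rewrite invr_ge0.
    have [h|h] := leP 0 (v - c).
      apply: (@le_trans _ _ (b^-1 * p (v - c))).
        by rewrite /p exponential_pdfE// (ger0_norm h) mulrA mulVf ?gt_eqF// mul1r mulNr.
      by rewrite lerDl mulr_ge0.
    apply: (@le_trans _ _ (b^-1 * p (- (v - c)))).
      rewrite /p exponential_pdfE; last by rewrite oppr_ge0 ltW.
      by rewrite (ltr0_norm h) mulrA mulVf ?gt_eqF// mul1r mulNr.
    by rewrite lerDr mulr_ge0.
rewrite ge0_integralD//=; last 2 first.
- by move=> v _; rewrite lee_fin mulr_ge0 ?invr_ge0.
- by move=> v _; rewrite lee_fin mulr_ge0 ?invr_ge0.
under eq_integral do rewrite EFinM.
under [X in (_ + X)%E]eq_integral do rewrite EFinM.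
rewrite !ge0_integralZl_EFin ?invr_ge0//=.
- by rewrite E1 E2 !mule1 -EFinD lee_fin; lra.
- by move=> v _; rewrite lee_fin.
- by apply/measurable_EFinP; exact: (measurableT_comp mpN).
- by move=> v _; rewrite lee_fin.
- by apply/measurable_EFinP; exact: measurableT_comp.
Qed.

Lemma dominated_by_laplace (f : R -> R) (A b c : R) : 0 < b -> 0 <= A ->
  measurable_fun [set: R] f -> (forall v, `|f v| <= A * laplace b c v) ->
  mu.-integrable [set: R] (EFin \o f) /\ `|\int[mu]_v f v| <= A * (2 / b).
Proof.
move=> b0 A0 mf hf.
have le1 : (\int[mu]_v `|(f v)%:E| <= (A * (2 / b))%:E)%E.
  apply: (@le_trans _ _ (\int[mu]_v (A%:E * (laplace b c v)%:E))%E).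
    apply: ge0_le_integral => //=.
    - by apply/measurable_EFinP; exact: measurableT_comp.
    - apply/measurable_EFinP; apply: measurable_funM => //.
      exact: measurable_laplace.
    - by move=> v _; rewrite lee_fin; exact: hf.
  rewrite ge0_integralZl_EFin//=.
  - by rewrite EFinM lee_wpmul2l// integral_laplace_le.
  - by move=> v _; rewrite lee_fin expR_ge0.
  - by apply/measurable_EFinP; exact: measurable_laplace.
have fi : mu.-integrable [set: R] (EFin \o f).
  apply/integrableP; split; first exact/measurable_EFinP.
  by apply: le_lt_trans le1 _; rewrite ltry.
split=> //; apply: le_trans (le_normr_Rintegral _ fi) _ => //.
have h := integrable_fin_num measurableT (integrable_norm fi).
rewrite /Rintegral -lee_fin fineK//; exact: le1.
Qed.

Lemma Rintegral_ge_unit_itv (f : R -> R) (c t : R) :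
  mu.-integrable [set: R] (EFin \o f) -> (forall v, 0 <= f v) ->
  (forall v, t - 1 <= v <= t -> c <= f v) -> c <= \int[mu]_v f v.
Proof.
move=> fi f0 fc; have mI : measurable [set` `[t - 1, t]] by exact: measurable_itv.
rewrite -lee_fin /Rintegral fineK; last exact: integrable_fin_num.
have mf := measurable_int _ fi.
apply: (@le_trans _ _ (\int[mu]_(v in [set` `[(t - 1)%R, t]]) (f v)%:E)%E); last first.
  by apply: ge0_subset_integral => //= v _; rewrite lee_fin.
have [c0|c0] := leP c 0.
  apply: (@le_trans _ _ 0%E); first by rewrite lee_fin.
  by apply: integral_ge0 => v _; rewrite lee_fin.
apply: (@le_trans _ _ (\int[mu]_(v in [set` `[(t - 1)%R, t]]) c%:E)%E).
  rewrite integral_cst//= lebesgue_measure_itv/= lte_fin ltrBlDr ltrDl ltr01.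
  by rewrite -EFinB opprB addrC subrK mule1.
apply: ge0_le_integral => //=.
- by move=> v _; rewrite lee_fin ltW.
- exact: measurable_funS mf.
Qed.

(* Substituting [expR v = (z / 2) * expR u] in the integral defining [besselK],
   with [D = z ^+ 2 / 4], and [t = expR v] in Euler's integral, where [D = 0],
   puts the Matern kernel and its normalization in the same form. *)
Definition mix_density nu D v : R := expR (nu * v - expR v - D * expR (- v)).

Definition mix_integral nu D : R := \int[mu]_v mix_density nu D v.

Lemma mix_densityE nu D v :
  mix_density nu D v = mix_density nu 0 v * expR (- (D * expR (- v))).
Proof. by rewrite /mix_density -expRD; congr expR; ring. Qed.

Lemma measurable_mix_density nu D : measurable_fun [set: R] (mix_density nu D).
Proof.
apply: measurableT_comp => //; apply: measurable_funB.
  by apply: measurable_funB => //; exact: measurable_funM.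
apply: measurable_funM => //; apply: measurableT_comp => //.
Qed.

(** A single term of the exponential series at [expR v], that of index [m], is at most its sum. *)
Lemma expR_opp_expR_le m v : expR (- expR v) <= m`!%:R * expR (- (m%:R * v)).
Proof.
have := expR_series_le m.+1 (expR_ge0 v).
rewrite big_ord_recr/= => h.
have {h} : expR v ^+ m / m`!%:R <= expR (expR v).
  by apply: le_trans h; rewrite lerDr sumr_ge0.
rewrite ler_pdivrMr ?ltr0n ?fact_gt0// !expRN -expRM_natl => h.
rewrite ler_pdivlMr ?expR_gt0// [leLHS]mulrC ler_pdivrMr ?expR_gt0//.
by rewrite [leRHS]mulrC.
Qed.

Lemma mix_density_integrable nu D : 0 < nu -> 0 <= D ->
  mu.-integrable [set: R] (EFin \o mix_density nu D).
Proof.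
(* The density decays like [expR (nu * v)] to the left. To the right, [expR_opp_expR_le] with
   [m > nu] gives decay at rate [m - nu]. The common rate [b] is the smaller of the two. *)
move=> nu0 D0; pose m := (Num.truncn nu).+1.
have mnu : nu < m%:R by exact: truncnS_gt.
pose b := Num.min nu (m%:R - nu).
have b0 : 0 < b by rewrite lt_min nu0 subr_gt0.
have [b1 b2] : b <= nu /\ b <= m%:R - nu by rewrite /b !ge_min !lexx orbT.
have fm1 : 1 <= m`!%:R :> R by rewrite ler1n fact_gt0.
have [] // := @dominated_by_laplace (mix_density nu D) m`!%:R b 0 b0.
- exact: measurable_mix_density.
- move=> v; rewrite ger0_norm ?expR_ge0// /laplace subr0.
  apply: (@le_trans _ _ (expR (nu * v) * expR (- expR v))).
    by rewrite -expRD ler_expR lerBlDr lerDl mulr_ge0// expR_ge0.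
  have [v0|v0] := leP 0 v.
    apply: (@le_trans _ _ (expR (nu * v) * (m`!%:R * expR (- (m%:R * v))))).
      by rewrite ler_wpM2l ?expR_ge0// expR_opp_expR_le.
    rewrite mulrCA ler_wpM2l// -expRD ler_expR ger0_norm//; nra.
  apply: (@le_trans _ _ (1 * expR (- (b * - v)))).
    rewrite mul1r -[leRHS]mulr1 ; apply: ler_pM; rewrite ?expR_ge0//.
    by rewrite ler_expR; nra.
  by rewrite (ltr0_norm v0) ler_wpM2r ?expR_ge0.
Qed.

Lemma mix_integral_gt0 nu D : 0 < nu -> 0 <= D -> 0 < mix_integral nu D.
Proof.
move=> nu0 D0.
(* This is a lower bound of the density on [[-1, 0]]. *)
apply: (@lt_le_trans _ _ (expR (- nu - 1 - D * expR 1))); first exact: expR_gt0.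
apply: (@Rintegral_ge_unit_itv _ _ 0).
- exact: mix_density_integrable.
- by move=> v; exact: expR_ge0.
- move=> v /andP[v1 v0]; rewrite ler_expR; apply: lerB; last first.
    by rewrite ler_wpM2l// ler_expR; lra.
  apply: lerB; first by nra.
  by rewrite expR_le1.
Qed.

Lemma GammaE nu : Gamma nu = mix_integral nu 0.
Proof.
rewrite /Gamma.
transitivity (\int[mu]_(t in `]0%R, +oo[) (expR ((nu - 1) * ln t) * expR (- t))).
  apply: eq_Rintegral => t; rewrite inE/= in_itv/= andbT => t0.
  by rewrite /powR gt_eqF.
rewrite /mix_integral /Rintegral; congr fine.
rewrite (ge0_integral_expR (G := fun t => expR ((nu - 1) * ln t) * expR (- t))).
- apply: eq_integral => v _; rewrite expRK /mix_density -!expRD.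
  by congr (expR _)%:E; ring.
- move=> t; rewrite in_itv/= andbT => t0; apply: cvgM.
    apply: continuous_comp; last exact: continuous_expR.
    by apply: cvgMr; exact: continuous_ln.
  apply: continuous_comp; last exact: continuous_expR.
  exact: continuousN.
- by move=> t _; rewrite mulr_ge0 ?expR_ge0.
Qed.

Lemma measurable_cosh : measurable_fun [set: R] (@cosh R).
Proof.
apply: measurable_funM => //; apply: measurable_funD => //.
exact: measurableT_comp.
Qed.

Lemma besselKE nu z : 0 < nu -> 0 < z ->
  besselK nu z = 2^-1 * expR (- (nu * ln (z / 2))) * mix_integral nu (z ^+ 2 / 4).
Proof.
(* Writing [cosh (nu * u)] as a half-sum of exponentials unfolds the half-line integral into that of
   [g] over the whole line. A shift by [ln (z / 2)] then turns [z * cosh u] into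
   [expR v + z ^+ 2 / 4 * expR (- v)]. *)
move=> nu0 z0; pose g u := 2^-1 * expR (nu * u - z * cosh u).
have mcosh : measurable_fun [set: R] (fun u : R => z * cosh u).
  by apply: measurable_funM => //; exact: measurable_cosh.
have mg : measurable_fun [set: R] g.
  apply: measurable_funM => //; apply: measurableT_comp => //.
  exact: measurable_funB.
have mEg : measurable_fun [set: R] (EFin \o g) by exact/measurable_EFinP.
have mEgN : measurable_fun [set: R] (EFin \o (g \o -%R)).
  by apply/measurable_EFinP; exact: measurableT_comp.
have g0 u : (0%:E <= (g u)%:E)%E by rewrite lee_fin mulr_ge0 ?expR_ge0.
have E1 : (\int[mu]_u (g u)%:E =
    \int[mu]_(u in `[0%R, +oo[) (expR (- (z * cosh u)) * cosh (nu * u))%:E)%E.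
  transitivity (\int[mu]_(u in `[0%R, +oo[) (g u)%:E +
      \int[mu]_(u in `[0%R, +oo[) (g (- u))%:E)%E.
    rewrite [in X in (_ + X)%E](ge0_integration_by_substitution0
      (f := EFin \o (g \o -%R)))//=.
    under [X in (_ + X)%E]eq_integral do rewrite opprK.
    rewrite -[X in (_ + X)%E]integral_itv_bndo_bndc; last first.
      by apply: measurable_funTS.
    rewrite -ge0_integral_setU//=.
    - congr (integral _ _ _); apply/seteqP; split => // u _ /=.
      by rewrite !in_itv/= andbT; case: (leP 0 u) => ?; [left|right].
    - exact: measurable_funTS.
    - rewrite disj_set2E; apply/eqP; rewrite -subset0 => u []/=.
      by rewrite !in_itv/= andbT; case: leP.
  rewrite -ge0_integralD//=; last 2 first.
  - exact: measurable_funTS.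
  - exact: measurable_funTS.
  apply: eq_integral => u _; rewrite -EFinD /g; congr EFin.
  have -> : cosh (- u) = cosh u by rewrite /cosh opprK addrC.
  by rewrite /cosh !expRD mulrN; field.
have E2 : (\int[mu]_u (g u)%:E = (2^-1 * expR (- (nu * ln (z / 2))))%:E *
    \int[mu]_v (mix_density nu (z ^+ 2 / 4) v)%:E)%E.
  rewrite -(ge0_integral_shift (- ln (z / 2)) mEg g0).
  rewrite -ge0_integralZl_EFin//= ?mulr_ge0 ?expR_ge0//; last 2 first.
  - by move=> v _; rewrite lee_fin expR_ge0.
  - by apply/measurable_EFinP; exact: measurable_mix_density.
  apply: eq_integral => v _; rewrite -EFinM -mulrA -expRD /g; congr (_ * expR _)%:E.
  rewrite /cosh opprB !expRD expRN !lnK ?posrE ?divr_gt0//.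
  by field; rewrite gt_eqF.
rewrite /besselK /mix_integral /Rintegral.
rewrite -E1 E2 fineM//.
apply: (integrable_fin_num measurableT).
by apply: mix_density_integrable => //; rewrite divr_ge0// exprn_ge0// ltW.
Qed.

End gaussian_mixture.

(** * Quadratic forms in the Matern kernel *)

Section matern_forms.
Context {R : realType} {d : nat}.
Local Notation mu := (@lebesgue_measure R).
Implicit Types (x y : 'rV[R]_d).

Lemma sqr_euclidean_norm x y : euclidean_norm (x - y) ^+ 2 = dist2 x y.
Proof.
rewrite sqr_sqrtr; last by apply: sumr_ge0 => k _; exact: sqr_ge0.
by apply: eq_bigr => k _; rewrite !mxE.
Qed.

Lemma dist2_eq0 x y : (dist2 x y == 0) = (x == y).
Proof.
apply/eqP/eqP => [/eqP|->]; last first.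
  by rewrite /dist2 big1// => k _; rewrite subrr expr0n.
rewrite psumr_eq0 => [|k _]; last exact: sqr_ge0.
move=> /allP h; apply/rowP => k; apply/eqP.
by rewrite -subr_eq0 -sqrf_eq0; exact: (h k (mem_index_enum k)).
Qed.

Lemma Rintegral_sum {I : Type} (s : seq I) (f : I -> R -> R) :
  (forall i, mu.-integrable [set: R] (EFin \o f i)) ->
  mu.-integrable [set: R] (EFin \o (fun v => \sum_(i <- s) f i v)) /\
  \int[mu]_v (\sum_(i <- s) f i v) = \sum_(i <- s) \int[mu]_v f i v.
Proof.
move=> fi; elim: s => [|i s [ih1 ih2]].
  have E : (fun v => \sum_(i <- [::]) f i v) = cst 0.
    by apply/funext => v; rewrite big_nil.
  rewrite E big_nil; split; first exact: integrable0.
  by rewrite /Rintegral integral0.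
have E : (fun v => \sum_(j <- i :: s) f j v) = (fun v => f i v + \sum_(j <- s) f j v).
  by apply/funext => v; rewrite big_cons.
rewrite E big_cons; split; last by rewrite RintegralD// ih2.
by apply: (integrableD measurableT (fi i) ih1).
Qed.

Lemma Rintegral_kernel_form {I V : Type} (s : seq I) (b : I -> R) (y : I -> V)
    (K : R -> V -> V -> R) :
  (forall u v, mu.-integrable [set: R] (EFin \o (fun t => K t u v))) ->
  mu.-integrable [set: R] (EFin \o (fun t => kernel_form (K t) s b y)) /\
  \int[mu]_t kernel_form (K t) s b y
  = kernel_form (fun u v => \int[mu]_t K t u v) s b y.
Proof.
move=> Ki.
have KZ i j : mu.-integrable [set: R]
    (EFin \o (fun t => b i * b j * K t (y i) (y j))).
  exact: (integrableZl measurableT (b i * b j) (Ki (y i) (y j))).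
have KS i := Rintegral_sum s (KZ i).
have KSS := Rintegral_sum s (fun i => (KS i).1).
split; first exact: KSS.1.
rewrite KSS.2; apply: eq_bigr => i _; rewrite (KS i).2.
by apply: eq_bigr => j _; rewrite RintegralZl.
Qed.

(** Chosen so that [z ^+ 2 / 4] is this rate times [dist2 x y], where [z] is the Bessel argument in
    the Matern kernel. *)
Definition matern_rate (nu rho : R) : R := nu / (2 * rho ^+ 2).

Variables nu rho sigma : R.
Hypotheses (nu0 : 0 < nu) (rho0 : 0 < rho) (sigma0 : 0 < sigma ^+ 2).

Local Notation a := (matern_rate nu rho).
Local Notation J0 := (mix_integral nu 0).

Let a0 : 0 < a. Proof. by rewrite divr_gt0// mulr_gt0// exprn_gt0. Qed.
Let J0_gt0 : 0 < J0. Proof. exact: mix_integral_gt0. Qed.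

(** Off the diagonal, the powers of 2 and [z] in front of the Bessel function cancel the factor
    produced by [besselKE]. On the diagonal the mixture integral is its own normalization [J0]. *)
Lemma maternE x y :
  matern nu rho sigma x y
  = sigma ^+ 2 / J0 * mix_integral nu (a * dist2 x y).
Proof.
rewrite /matern; have [->|xy] := eqVneq x y.
  have /eqP -> : dist2 y y == 0 by rewrite dist2_eq0.
  by rewrite mulr0 divfK// gt_eqF.
set z := _ * (_ / rho).
have n0 : 0 < euclidean_norm (x - y).
  rewrite lt_neqAle sqrtr_ge0 andbT eq_sym -sqrf_eq0 sqr_euclidean_norm.
  by rewrite dist2_eq0.
have z0 : 0 < z.
  by apply: mulr_gt0; [rewrite sqrtr_gt0 mulr_gt0 | exact: divr_gt0].
have zE : z ^+ 2 / 4 = a * dist2 x y.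
  rewrite /z exprMn sqr_sqrtr; last by rewrite mulr_ge0// ltW.
  rewrite expr_div_n sqr_euclidean_norm /matern_rate.
  by field; rewrite gt_eqF.
rewrite besselKE// GammaE zE.
have H : 2 `^ (1 - nu) * z `^ nu * (2^-1 * expR (- (nu * ln (z / 2)))) = 1.
  have h2 : 2^-1 = expR (- ln 2) :> R by rewrite expRN lnK ?posrE.
  rewrite ln_div ?posrE// h2 /powR !gt_eqF//.
  by rewrite -!expRD -[RHS]expR0; congr expR; ring.
rewrite -[RHS]mul1r -[X in _ = X * _]H; ring.
Qed.

Lemma matern_diag x : matern nu rho sigma x x = sigma ^+ 2.
Proof. by rewrite /matern eqxx. Qed.

Section mixture_form.
Context {I : Type}.
Variables (s : seq I) (b : I -> R) (y : I -> 'rV[R]_d).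

Definition mixture_form v : R :=
  mix_density nu 0 v * kernel_form (gauss (a * expR (- v))) s b y.

Let mixture_formE v : mixture_form v =
  kernel_form (fun u w => mix_density nu (a * dist2 u w) v) s b y.
Proof.
rewrite /mixture_form -[LHS]addr0 -[X in _ + X](kernel_form0 s b y) -kernel_form_lin.
apply: eq_kernel_form => u w.
by rewrite addr0 [RHS]mix_densityE; congr (_ * expR _); ring.
Qed.

Let dens_integrable (u w : 'rV[R]_d) :
  mu.-integrable [set: R] (EFin \o mix_density nu (a * dist2 u w)).
Proof. by apply: mix_density_integrable => //; rewrite mulr_ge0 ?dist2_ge0 ?ltW. Qed.

Lemma integrable_mixture_form : mu.-integrable [set: R] (EFin \o mixture_form).
Proof.
have -> : mixture_form = fun v => kernel_form
    (fun u w : 'rV[R]_d => mix_density nu (a * dist2 u w) v) s b y.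
  by apply/funext => v; rewrite mixture_formE.
by have [] := Rintegral_kernel_form s b y dens_integrable.
Qed.

Lemma matern_formE :
  kernel_form (matern nu rho sigma) s b y
  = sigma ^+ 2 / J0 * \int[mu]_v mixture_form v.
Proof.
have -> : mixture_form = fun v => kernel_form
    (fun u w : 'rV[R]_d => mix_density nu (a * dist2 u w) v) s b y.
  by apply/funext => v; rewrite mixture_formE.
have [_ ->] := Rintegral_kernel_form s b y dens_integrable.
rewrite -[RHS]addr0 -[X in _ + X](kernel_form0 s b y) -kernel_form_lin.
by apply: eq_kernel_form => u w; rewrite addr0 maternE.
Qed.

Lemma mixture_form_ge0 v : 0 <= mixture_form v.
Proof. by rewrite mulr_ge0 ?expR_ge0// gauss_form_ge0// mulr_ge0 ?expR_ge0// ltW. Qed.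

(** The two regimes meet at [v = c], where the Gaussian rate times [D] is 1. To the left the form
    has only its trivial bound, but the weight [expR (nu * v)] decays. To the right annihilation
    gains [expR (m%:R * (c - v))], which beats the growth of the weight since [m > nu]. *)
Lemma mixture_form_small (m : nat) (D v : R) : nu < m%:R ->
  annihilates m s b y -> 0 < D -> (forall i j, dist2 (y i) (y j) <= D) ->
  `|mixture_form v| <= (\sum_(i <- s) `|b i|) ^+ 2 * expR 1 * expR (nu * ln (a * D))
    * laplace (Num.min nu (m%:R - nu)) (ln (a * D)) v.
Proof.
move=> mnu ann D0 hD; set W := (\sum_(i <- s) _) ^+ 2.
set c := ln _; set bb := Num.min _ _.
have [b1 b2] : bb <= nu /\ bb <= m%:R - nu by rewrite /bb !ge_min !lexx orbT.
have W0 : 0 <= W by exact: sqr_ge0.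
have s0 : 0 <= a * expR (- v) by rewrite mulr_ge0 ?expR_ge0// ltW.
have e1 : 1 <= expR 1 :> R by have := expR_ge1Dx (1 : R); lra.
have dens : mix_density nu 0 v <= expR (nu * v).
  by rewrite ler_expR mul0r subr0 gerBl expR_ge0.
have sD : a * expR (- v) * D = expR (c - v).
  by rewrite expRD /c lnK ?posrE; [ring | exact: mulr_gt0].
rewrite normrM (ger0_norm (expR_ge0 _)) /laplace.
have [vc|cv] := leP v c.
  apply: (@le_trans _ _ (expR (nu * v) * (W * 1))).
    apply: ler_pM; rewrite ?expR_ge0// mulr1; exact: gauss_form_bound.
  rewrite ler0_norm ?subr_le0// -[leRHS]mulrA -expRD mulrC -[leRHS]mulrA.
  rewrite -mulrA ler_wpM2l//; apply: ler_pM; rewrite ?expR_ge0// ler_expR; nra.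
apply: (@le_trans _ _ (expR (nu * v) * (W * (expR 1 * expR (c - v) ^+ m)))).
  apply: ler_pM; rewrite ?expR_ge0// -sD; apply: gauss_form_small => //.
  by rewrite sD expR_le1 subr_le0 ltW.
rewrite gtr0_norm ?subr_gt0// -expRM_natl.
have -> : expR (nu * v) * (W * (expR 1 * expR (m%:R * (c - v))))
    = W * expR 1 * expR (nu * v + m%:R * (c - v)) by rewrite expRD; ring.
rewrite -[leRHS]mulrA -expRD; apply: ler_wpM2l.
  by rewrite mulr_ge0 ?expR_ge0.
by rewrite ler_expR; nra.
Qed.

End mixture_form.

Lemma matern_form_small (m : nat) : nu < m%:R -> exists2 C : R, 0 < C &
  forall (I : Type) (s : seq I) (b : I -> R) (y : I -> 'rV[R]_d) (D : R),
  annihilates m s b y -> 0 < D -> (forall i j, dist2 (y i) (y j) <= D) ->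
  kernel_form (matern nu rho sigma) s b y
    <= C * (\sum_(i <- s) `|b i|) ^+ 2 * D `^ nu.
Proof.
move=> mnu; pose bb := Num.min nu (m%:R - nu).
have bb0 : 0 < bb by rewrite lt_min nu0 subr_gt0.
exists (sigma ^+ 2 / J0 * expR 1 * a `^ nu * (2 / bb)).
  apply: mulr_gt0; last exact: divr_gt0.
  by rewrite mulr_gt0 ?powR_gt0// mulr_gt0 ?expR_gt0// divr_gt0.
move=> I s b y D ann D0 hD; set W := (\sum_(i <- s) _) ^+ 2.
have [] := @dominated_by_laplace R (mixture_form s b y)
  (W * expR 1 * expR (nu * ln (a * D))) bb (ln (a * D)) bb0.
- by rewrite mulr_ge0 ?expR_ge0// mulr_ge0 ?expR_ge0 ?sqr_ge0.
- have := measurable_int _ (integrable_mixture_form s b y).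
  by move/measurable_EFinP.
- by move=> v; exact: mixture_form_small.
move=> _ /(le_trans (ler_norm _)) h.
rewrite matern_formE.
have -> : sigma ^+ 2 / J0 * expR 1 * a `^ nu * (2 / bb) * W * D `^ nu
    = sigma ^+ 2 / J0 * (W * expR 1 * expR (nu * ln (a * D)) * (2 / bb)).
  have -> : expR (nu * ln (a * D)) = a `^ nu * D `^ nu.
    rewrite -powRM ?ltW// /powR gt_eqF// mulr_gt0//.
  ring.
by rewrite ler_wpM2l// divr_ge0// ltW.
Qed.

Lemma matern_form_grid_ge : exists2 C : R, 0 < C &
  forall (n : nat) (b : {ffun 'I_d -> 'I_n} -> R), (0 < n)%N ->
  C * n%:R `^ (- (2 * nu)) * \sum_j b j ^+ 2
    <= kernel_form (matern nu rho sigma) (index_enum _) b (@grid_point R d n).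
Proof.
(* This [q] meets the threshold [4 * q * 2 ^+ d = 1 / 2] of [gauss_grid_off_diag] exactly. *)
pose q : R := (8 * 2 ^+ d)^-1; pose del := Num.min 1 (a * q).
have p2 : 0 < 2 ^+ d :> R by rewrite exprn_gt0.
have q0 : 0 < q by rewrite invr_gt0 mulr_gt0.
have del0 : 0 < del by rewrite lt_min ltr01 mulr_gt0.
have [del1 delq] : del <= 1 /\ del <= a * q by rewrite /del !ge_min !lexx orbT.
exists (sigma ^+ 2 / J0 * (1 / 2 * expR (- nu - 1) * del `^ nu)).
  apply: mulr_gt0; first exact: divr_gt0.
  by rewrite mulr_gt0 ?powR_gt0// mulr_gt0 ?expR_gt0.
move=> n b n0; set B := \sum_j _.
have B0 : 0 <= B by apply: sumr_ge0 => j _; exact: sqr_ge0.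
have nR : 0 < n%:R :> R by rewrite ltr0n.
have n1 : 1 <= n%:R :> R by rewrite ler1n.
(* Only [v] in [[t - 1, t]] is kept. There [expR v <= 1] because [del <= 1], which bounds the weight
   below. Because [del <= a * q], the Gaussian exponent at adjacent grid points is at least [q^-1],
   and [expR (- q^-1) <= q]. *)
pose t := ln (del / n%:R ^+ 2).
have tE : expR t = del / n%:R ^+ 2.
  by rewrite lnK// posrE divr_gt0// exprn_gt0.
have delnu : expR (nu * t) = del `^ nu * n%:R `^ (- (2 * nu)).
  rewrite /t ln_div ?posrE ?exprn_gt0// lnXn// /powR !gt_eqF// -expRD.
  by congr expR; rewrite -mulr_natr; ring.
rewrite matern_formE.
have -> : sigma ^+ 2 / J0 * (1 / 2 * expR (- nu - 1) * del `^ nu)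
      * n%:R `^ (- (2 * nu)) * B
    = sigma ^+ 2 / J0
      * (expR (- nu - 1) * expR (nu * t) * ((1 - 1 / 2) * B)).
  by rewrite delnu; field; rewrite gt_eqF.
apply: ler_wpM2l; first by rewrite divr_ge0 ?sqr_ge0// ltW.
apply: (@Rintegral_ge_unit_itv _ _ _ t).
- exact: integrable_mixture_form.
- by move=> v; exact: mixture_form_ge0.
move=> v /andP[v1 v2].
apply: ler_pM => //.
- by rewrite mulr_ge0//; lra.
- rewrite -expRD ler_expR mul0r subr0.
  have : expR v <= 1.
    apply: (@le_trans _ _ (expR t)); first by rewrite ler_expR.
    by rewrite tE ler_pdivrMr ?exprn_gt0// mul1r (le_trans del1)// exprn_ege1.
  have : 0 <= nu * (v - (t - 1)) 
    by apply: mulr_ge0; [exact: ltW | rewrite subr_ge0].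
  lra.
have s0 : 0 <= a * expR (- v) by rewrite mulr_ge0 ?expR_ge0// ltW.
apply: kernel_form_diag_dominant.
- by move=> u w; rewrite /gauss dist2C.
- by move=> u w; exact: expR_ge0.
- move=> u; have /eqP E : dist2 u u == 0 by rewrite dist2_eq0.
  by rewrite /gauss E mulr0 oppr0 expR0.
move=> j; apply: (@gauss_grid_off_diag _ _ _ _ _ q) => //.
- exact: ltW.
- have -> : 4 * q * 2 ^+ d = 1 / 2 by rewrite /q; field; rewrite gt_eqF.
  by [].
have h1 : q^-1 <= a * expR (- v) / n%:R ^+ 2.
  rewrite ler_pdivlMr ?exprn_gt0//.
  apply: (@le_trans _ _ (a * expR (- t))); last first.
    by rewrite ler_pM2l// ler_expR lerN2.
  rewrite expRN tE invf_div.
  have -> : a * (n%:R ^+ 2 / del) = a / del * n%:R ^+ 2 by ring.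
  rewrite ler_wpM2r ?sqr_ge0//.
  by rewrite ler_pdivlMr// ler_pdivrMl// mulrC.
apply: (@le_trans _ _ (expR (- q^-1))); first by rewrite ler_expR lerN2.
rewrite expRN -[leRHS]invrK lef_pV2 ?posrE ?invr_gt0 ?expR_gt0//.
by apply: le_trans (expR_ge1Dx _); rewrite lerDr.
Qed.

End matern_forms.

(** * Deterministic algorithms *)

Section algorithms_theory.
Context {R : realType} {d : nat}.
Implicit Types (pi : algorithm R d) (f g : 'rV[R]_d -> R).

(** Agreement at the queries made on [g] suffices: inductively, the queries made on [f] are the same
    points. *)
Lemma history_eq pi f g T :
  (forall t, (t < T)%N -> f (query pi g t) = g (query pi g t)) ->
  history pi f T = history pi g T.
Proof.
elim: T => [//|T ih] fg /=.
rewrite ih; last by move=> t tT; apply: fg; exact: ltnW.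
apply/val_inj; rewrite /=; congr (rcons _ (_, _)).
exact: fg.
Qed.

Lemma query_eq pi f g T :
  (forall t, (t < T)%N -> f (query pi g t) = g (query pi g t)) ->
  query pi f T = query pi g T.
Proof. by move=> fg; rewrite /query (history_eq fg). Qed.

Lemma nth_history pi f T t x0 : (t < T)%N ->
  nth x0 (history pi f T) t = (pi t (history pi f t), f (query pi f t)).
Proof.
elim: T => [//|T ih]; rewrite ltnS leq_eqVlt => /predU1P[->|tT] /=.
  by rewrite nth_rcons size_tuple ltnn eqxx.
by rewrite nth_rcons size_tuple tT; exact: ih.
Qed.

Lemma simple_regret_le pi f T (e : R) t : (t < T)%N ->
  (forall x, unit_cube x -> f (query pi f t) <= f x + e) ->
  simple_regret pi f T <= e.
Proof.
move=> tT h; rewrite /simple_regret lerBlDr.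
apply: (@le_trans _ _ (f (query pi f t))).
  exact: (bigmin_le _ (Ordinal tT)).
rewrite addrC -lerBlDr; apply: lb_le_inf.
  by exists (f (query pi f t)); exists (query pi f t) => //=; exact: valP.
by move=> _ [x xc <-]; rewrite lerBlDr; exact: h.
Qed.

(** The run on [f] coincides with the run on the zero function, so the best observed value is 0. The
    bound [- B] ensures that [inf] is a true infimum and not its default value. *)
Lemma simple_regret_ge pi f T (B : R) y :
  (forall x, - B <= f x) ->
  (forall t, (t < T)%N -> f (query pi (fun=> 0) t) = 0) -> (0 < T)%N ->
  unit_cube y ->
  - f y <= simple_regret pi f T.
Proof.
move=> fB f0 T0 yc.
have q t : (t < T)%N -> f (query pi f t) = 0.
  move=> tT; rewrite (@query_eq _ _ (fun=> 0)) ?f0// => u ut.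
  by rewrite f0// (ltn_trans ut).
rewrite /simple_regret (eq_bigr (fun=> 0)); last by move=> i _; exact: q.
rewrite q//.
have -> : \big[Num.min/0]_(i < T) (0 : R) = 0.
  by elim/big_rec: _ => // i x _ ->; rewrite minxx.
rewrite sub0r lerN2; apply: ge_inf; last by exists y.
by exists (- B) => _ [x _ <-].
Qed.

(** Nonadaptive sampling followed by one choice. The default 0 of [nth] is never reached, since
    [choice] is called only when the history holds at least [N] pairs. *)
Definition sample_then_choose N (pts : 'I_N -> cube_point R d)
    (choice : N.-tuple R -> cube_point R d) : algorithm R d :=
  fun t h => if insub t is Some i then pts i
             else choice [tuple nth 0 (map snd h) i | i < N].

Lemma sample_then_choose_query N pts choice f :
  query (@sample_then_choose N pts choice) f N
  = val (choice [tuple f (val (pts i)) | i < N]).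
Proof.
rewrite /query /sample_then_choose insubF ?ltnn//.
congr (val (choice _)); apply/eq_from_tnth => i; rewrite !tnth_mktuple.
have x0 : cube_point R d * R by exact: (pts i, 0).
rewrite (nth_map x0) ?size_tuple// nth_history//=.
by rewrite /query insubT//= => iN; congr (f (val (pts _))); exact: val_inj.
Qed.

(** The chosen point minimizes the surrogate [F] up to [e]. The regret collects this slack and the
    approximation errors at the chosen point and at the competitor, hence [3 * e]. The lower bound
    on [f] makes the infimum of [F] finite, so a near-minimizer exists and [xget] does not return
    its default [x0]. *)
Lemma approx_algorithm (S : set ('rV[R]_d -> R)) N
    (pts : 'I_N -> cube_point R d)
    (c : cube_point R d -> 'I_N -> R) (e : R) :
  0 < e -> inhabited (cube_point R d) ->
  (forall f, S f -> exists B : R, forall x, - B <= f x) ->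
  (forall f, S f -> forall x,
     `|f (val x) - \sum_(i < N) c x i * f (val (pts i))| <= e) ->
  exists pi, forall f, S f -> simple_regret pi f N.+1 <= 3 * e.
Proof.
move=> e0 [x0] Sbd Sapp.
pose F (v : N.-tuple R) x := \sum_(i < N) c x i * tnth v i.
pose choice v := xget x0 [set x | forall y, F v x <= F v y + e].
exists (sample_then_choose pts choice) => f Sf.
apply: (@simple_regret_le _ _ _ _ N) => // x xc.
rewrite sample_then_choose_query.
set v := [tuple _ | i < N].
have FE y : F v y = \sum_(i < N) c y i * f (val (pts i)).
  by apply: eq_bigr => i _; rewrite tnth_mktuple.
have app y : `|f (val y) - F v y| <= e by rewrite FE; exact: Sapp.
have [y hy] : exists y, forall z, F v y <= F v z + e.
  have [B hB] := Sbd f Sf.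
  have hinf : has_inf [set F v z | z in [set: cube_point R d]].
    split; first by exists (F v x0); exists x0.
    exists (- B - e) => _ [z _ <-].
    by have := app z; have := hB (val z); rewrite ler_norml => ? /andP[]; lra.
  have [_ [y _ <-] hy] := inf_adherent e0 hinf.
  exists y => z; apply/ltW/(lt_le_trans hy); rewrite lerD2r.
  by apply: ge_inf; [case: hinf | exists z].
have hc : forall z, F v (choice v) <= F v z + e.
  rewrite /choice.
  by apply: (@xgetPex _ x0 [set x | forall y, F v x <= F v y + e]); exists y.
have := hc (Sub x xc); have := app (choice v); have := app (Sub x xc).
rewrite SubK !ler_norml => /andP[? ?] /andP[? ?]; lra.
Qed.

End algorithms_theory.

(** * Upper bound *)

Section lagrange_interpolation.
Context {R : realType}.

(** The weights are the Lagrange basis polynomials at [t]. Nodes and [t] lie in [[0, 1]], so each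
    numerator is at most 1 in absolute value and the inverse denominators give a [B] independent of
    [t]. *)
Lemma lagrange_weights (m : nat) : (0 < m)%N ->
  exists2 B : R, 0 <= B & forall t : R, 0 <= t <= 1 ->
  exists l : 'I_m -> R,
    (forall p : {poly R}, (size p <= m)%N ->
      \sum_(j < m) l j * p.[j%:R / m%:R] = p.[t]) /\
    (\sum_(j < m) `|l j| <= B).
Proof.
move=> m0; pose xi (j : nat) : R := j%:R / m%:R.
have mR : m%:R != 0 :> R by rewrite pnatr_eq0 -lt0n.
have xi_inj : injective xi.
  by move=> i j /(mulIf (invr_neq0 mR))/eqP; rewrite eqr_nat => /eqP.
pose L (i : 'I_m) : {poly R} := \prod_(j < m | j != i) ('X - (xi j)%:P).
exists (\sum_(i < m) `|(L i).[xi i]^-1|); first exact: sumr_ge0.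
move=> t t01; exists (fun i => (tnth (lagrange m xi) i : {poly R}).[t]); split.
  move=> p pm; rewrite [in RHS](lagrange_gen m0 xi_inj pm) horner_sum.
  by apply: eq_bigr => j _; rewrite hornerM hornerC mulrC.
apply: ler_sum => i _; rewrite lagrangeE//= hornerM hornerC normrM.
rewrite ler_piMr// horner_prod normr_prod.
apply: prodr_ile1 => j _; rewrite normr_ge0/= hornerXsubC.
have : 0 <= xi j <= 1.
  by rewrite /xi divr_ge0//= ler_pdivrMr ?ltr0n// mul1r ler_nat ltnW.
by rewrite ler_norml; move: t01; lra.
Qed.

Context {d : nat}.

Definition node M m (c : 'I_d -> 'I_M) (j : {ffun 'I_d -> 'I_m}) : 'rV[R]_d :=
  \row_k (((c k)%:R + (j k)%:R / m%:R) / M%:R).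

Lemma node_cell M m (c : 'I_d -> 'I_M) (j : {ffun 'I_d -> 'I_m}) k :
  0 <= node c j ord0 k * M%:R - (c k)%:R <= 1.
Proof.
have M0 : M%:R != 0 :> R.
  by rewrite pnatr_eq0 -lt0n (leq_trans _ (ltn_ord (c k))).
have m0 : (0 < m)%N by rewrite (leq_trans _ (ltn_ord (j k))).
rewrite mxE divfK// addrC addKr divr_ge0//= ler_pdivrMr ?ltr0n//.
by rewrite mul1r ler_nat ltnW.
Qed.

Lemma unit_cube_node M m (c : 'I_d -> 'I_M) (j : {ffun 'I_d -> 'I_m}) :
  unit_cube (node c j).
Proof.
apply/forallP => k; have := node_cell c j k; move: (node _ _ _ _) => z.
have M0 : 0 < M%:R :> R by rewrite ltr0n (leq_trans _ (ltn_ord (c k))).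
have cM : (c k)%:R + 1 <= M%:R :> R by rewrite natr1 ler_nat ltn_ord.
have c0 : 0 <= (c k)%:R :> R by [].
move=> /andP[h1 h2]; apply/andP; split.
  by rewrite -(pmulr_lge0 _ M0); lra.
by rewrite -(ler_pM2r M0); lra.
Qed.

Lemma cell_exists M (x : 'rV[R]_d) : (0 < M)%N -> unit_cube x ->
  exists c : 'I_d -> 'I_M,
    forall k, 0 <= x ord0 k * M%:R - (c k)%:R <= 1.
Proof.
move=> M0 /forallP xc.
suff /choice [c hc] : forall k, exists c : 'I_M,
    0 <= x ord0 k * M%:R - c%:R <= 1 by exists c.
move=> k; have /andP[x0 x1] := xc k; set z := x ord0 k in x0 x1 *.
have MR : 0 < M%:R :> R by rewrite ltr0n.
have z0 : 0 <= z * M%:R by rewrite mulr_ge0// ltW.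
have [zM|zM] := ltnP (Num.truncn (z * M%:R)) M.
  exists (Ordinal zM) => /=; have := truncn_itv z0; rewrite -natr1; lra.
(* On the upper face of the cube the truncation reaches [M]; such a coordinate is put in the last
   cell. *)
have M1 : (M.-1 < M)%N by rewrite prednK.
exists (Ordinal M1) => /=.
have zz : M%:R <= z * M%:R.
  by rewrite -truncn_ge_nat.
have z1 : z * M%:R <= M%:R by rewrite ler_piMl// ltW.
have : M%:R = M.-1%:R + 1 :> R by rewrite natr1 prednK.
lra.
Qed.

Lemma monomialE (u : seq 'I_d) (x : 'rV[R]_d) :
  monomial u x = \prod_k x ord0 k ^+ count_mem k u.
Proof.
rewrite /monomial; elim: u => [|i u ih].
  by rewrite big_nil big1.
rewrite big_cons ih [RHS](bigD1 i)//= [in LHS](bigD1 i)//= eqxx exprS mulrA.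
congr (_ * _); apply: eq_bigr => k ki.
by rewrite eq_sym (negPf ki).
Qed.

(** With product weights, sums over the tensor grid factor into one-dimensional ones, for the
    monomials as for the absolute values. In each coordinate the exponent is at most [size u < m],
    so one-dimensional exactness applies. *)
Lemma local_interpolation m : (0 < m)%N -> exists2 W : R, 0 <= W &
  forall M (x : 'rV[R]_d) (c : 'I_d -> 'I_M),
  (forall k, 0 <= x ord0 k * M%:R - (c k)%:R <= 1) ->
  exists w : {ffun 'I_d -> 'I_m} -> R,
    (forall u : seq 'I_d, (size u < m)%N ->
      \sum_j w j * monomial u (node c j) = monomial u x) /\
    \sum_j `|w j| <= W.
Proof.
move=> m0; have [B B0 hB] := lagrange_weights m0.
exists (\prod_(k < d) B); first by apply: prodr_ge0.
move=> M x c xc.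
have /choice [l hl] := fun k => hB _ (xc k).
exists (fun j => \prod_k l k (j k)); split; last first.
  under eq_bigr do rewrite normr_prod.
  rewrite -(bigA_distr_bigA (fun k i => `|l k i|)).
  by apply: ler_prod => k _; rewrite sumr_ge0//=; exact: (hl k).2.
move=> u um; rewrite monomialE.
transitivity (\sum_(j : {ffun 'I_d -> 'I_m}) \prod_k
    (l k (j k) * (((c k)%:R + (j k)%:R / m%:R) / M%:R) ^+ count_mem k u)).
  apply: eq_bigr => j _; rewrite monomialE -big_split/=.
  by apply: eq_bigr => k _; rewrite mxE.
rewrite -(bigA_distr_bigA (fun k i =>
  l k i * (((c k)%:R + i%:R / m%:R) / M%:R) ^+ count_mem k u)).
apply: eq_bigr => k _.
(* The [k]-th coordinate power, in the local variable of the cell. *)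
pose p : {poly R} := (M%:R^-1 *: ('X + (c k)%:R%:P)) ^+ count_mem k u.
have pE t : p.[t] = (((c k)%:R + t) / M%:R) ^+ count_mem k u.
  by rewrite horner_exp hornerZ hornerD hornerX hornerC addrC mulrC.
have M0 : M%:R != 0 :> R.
  by rewrite pnatr_eq0 -lt0n (leq_trans _ (ltn_ord (c k))).
have -> : x ord0 k ^+ count_mem k u = p.[x ord0 k * M%:R - (c k)%:R].
  by rewrite pE addrC subrK mulfK.
rewrite -(hl k).1; first by apply: eq_bigr => i _; rewrite pE.
apply: leq_trans (size_poly_exp_leq _ _) _.
apply: (@leq_trans (1 * count_mem k u).+1); last first.
  by rewrite mul1n; apply: leq_ltn_trans um; exact: count_size.
rewrite ltnS leq_mul2r; apply/orP; right.
have : (size (M%:R^-1 *: ('X + (c k)%:R%:P) : {poly R})%R <= 2)%N.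
  apply: leq_trans (size_scale_leq _ _) _.
  apply: leq_trans (size_polyD _ _) _; rewrite size_polyX geq_max/=.
  by apply: leq_trans (size_polyC_leq1 _) _.
by case: size.
Qed.

End lagrange_interpolation.

Section approximation.
Context {R : realType} {d : nat}.
Variables nu rho sigma : R.
Hypotheses (hd : (0 < d)%N).
Hypotheses (nu0 : 0 < nu) (rho0 : 0 < rho) (sigma0 : 0 < sigma ^+ 2).

(** The interpolation error is a functional supported on one cell, of squared diameter at most
    [d / M ^+ 2], and it annihilates low degrees. Its dual norm is therefore controlled by
    [matern_form_small]. *)
Lemma local_approximation (m : nat) : nu < m%:R -> exists2 C : R, 0 < C &
  forall H ip, is_rkhs (@matern R d nu rho sigma) H ip ->
  forall (M : nat) (x : 'rV[R]_d), (0 < M)%N -> unit_cube x ->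
  exists (c : 'I_d -> 'I_M) (w : {ffun 'I_d -> 'I_m} -> R),
  forall f, H f ->
    `|f x - \sum_j w j * f (node c j)| <= C * M%:R `^ (- nu) * ip_norm ip f.
Proof.
move=> mnu; have m0 : (0 < m)%N by rewrite -(ltr_nat R) (lt_trans nu0).
have [W W0 hW] := @local_interpolation R d m m0.
have [C C0 hC] := @matern_form_small R d nu rho sigma nu0 rho0 sigma0 m mnu.
have dR : 0 < d%:R :> R by rewrite ltr0n.
exists (Num.sqrt (C * (1 + W) ^+ 2 * d%:R `^ nu)).
  by rewrite sqrtr_gt0 !mulr_gt0 ?exprn_gt0 ?powR_gt0//; lra.
move=> H ip hk M x M0 xc.
have [c hc] := cell_exists M0 xc; have [w [w1 w2]] := hW M x c hc.
exists c, w => f Hf.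
(* [None] stands for the point [x], with weight 1, and [Some j] for a node, with weight [- w j]. *)
pose s := None :: map Some (index_enum {ffun 'I_d -> 'I_m}).
pose b (o : option {ffun 'I_d -> 'I_m}) := if o is Some j then - w j else 1.
pose y (o : option {ffun 'I_d -> 'I_m}) := if o is Some j then node c j else x.
have sumE (g : 'rV[R]_d -> R) :
    \sum_(o <- s) b o * g (y o) = g x - \sum_j w j * g (node c j).
  rewrite big_cons big_map mul1r -sumrN; congr (_ + _).
  by apply: eq_bigr => j _; rewrite mulNr.
have ann : annihilates m s b y.
  by move=> u um; rewrite (sumE (monomial u)) w1// subrr.
have MR : 0 < M%:R :> R by rewrite ltr0n.
have cell o k : 0 <= y o ord0 k * M%:R - (c k)%:R <= 1.
  by case: o => [j|] /=; [exact: node_cell | exact: hc].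
have hD o o' : dist2 (y o) (y o') <= d%:R / M%:R ^+ 2.
  rewrite ler_pdivlMr ?exprn_gt0// /dist2 big_distrl/=.
  have -> : d%:R = \sum_(k < d) (1 : R) by rewrite sumr_const card_ord.
  apply: ler_sum => k _; rewrite -exprMn mulrBl.
  have := cell o k; have := cell o' k.
  set p := _ * M%:R; set q := _ * M%:R => /andP[? ?] /andP[? ?].
  have : 0 <= (1 - (q - p)) * (1 + (q - p)) by apply: mulr_ge0; lra.
  lra.
rewrite -sumE; apply: le_trans (rkhs_functional_bound hk s b y Hf) _.
rewrite mulrC ler_wpM2r ?sqrtr_ge0//.
apply: (@le_trans _ _ (Num.sqrt
  (C * (1 + W) ^+ 2 * d%:R `^ nu * (M%:R `^ (- nu)) ^+ 2))); last first.
  rewrite sqrtrM; first by rewrite sqrtr_sqr ger0_norm ?powR_ge0.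
  by rewrite mulr_ge0 ?powR_ge0// mulr_ge0 ?sqr_ge0// ltW.
apply: ler_wsqrtr; apply: le_trans (hC _ s b y _ ann _ hD) _.
  by rewrite divr_gt0// exprn_gt0.
have -> : (d%:R / M%:R ^+ 2) `^ nu = d%:R `^ nu * (M%:R `^ (- nu)) ^+ 2 :> R.
  rewrite powRM ?invr_ge0 ?exprn_ge0// ?ltW//; congr (_ * _).
  rewrite -powR_mulrn ?powR_ge0// -powRrM -powR_inv1 ?exprn_ge0 ?ltW//.
  by rewrite -powR_mulrn ?ltW// -!powRrM; congr (_ `^ _); ring.
have bW : \sum_(o <- s) `|b o| <= 1 + W.
  by rewrite big_cons big_map normr1 lerD2l; under eq_bigr do rewrite normrN.
rewrite -[leRHS]mulrA; apply: ler_wpM2r.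
  by rewrite mulr_ge0 ?sqr_ge0 ?powR_ge0.
apply: ler_wpM2l; first exact: ltW.
rewrite ler_sqr ?nnegrE//; last lra.
by apply: sumr_ge0.
Qed.

End approximation.

(** * Lower bound *)

Lemma sqr_le_sqr (R : realType) (u v : R) : `|u| <= v -> u ^+ 2 <= v ^+ 2.
Proof.
rewrite ler_norml => /andP[h1 h2].
have : 0 <= (v - u) * (v + u) by apply: mulr_ge0; lra.
lra.
Qed.

Lemma exists_argmax (R : realType) (I : finType) (i0 : I) (F : I -> R) :
  exists j, forall i, F i <= F j.
Proof.
case: (@Order.TotalTheory.arg_maxP _ _ I i0 predT F isT) => j _ h.
by exists j => i; exact: h.
Qed.

Section lower_bound.
Context {R : realType} {d : nat}.
Variables nu rho sigma : R.
Variables (H : set ('rV[R]_d -> R)).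
Variables (ip : ('rV[R]_d -> R) -> ('rV[R]_d -> R) -> R).
Hypothesis hk : is_rkhs (matern nu rho sigma) H ip.

Lemma rkhs_bounded f x : H f -> - (ip_norm ip f * Num.sqrt (sigma ^+ 2)) <= f x.
Proof.
move=> Hf; have := rkhs_functional_bound hk [:: tt] (fun=> 1) (fun=> x) Hf.
rewrite /kernel_form !big_cons !big_nil !addr0 !mul1r matern_diag.
by rewrite ler_norml => /andP[].
Qed.

Lemma underdetermined_solution (I : finType) T (A : I -> 'I_T -> R) :
  (T < #|I|)%N -> exists2 b : I -> R, (exists i, b i != 0) &
    forall t, \sum_i b i * A i t = 0.
Proof.
move=> TI; pose M : 'M[R]_(#|I|, T) := \matrix_(i, t) A (enum_val i) t.
have kM : kermx M != 0.
  rewrite -mxrank_eq0 mxrank_ker subn_eq0 -ltnNge.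
  by apply: leq_ltn_trans TI; exact: rank_leq_col.
have /rowV0Pn [i /sub_kermxP hM i0] := kM.
exists (fun j => i ord0 (enum_rank j)).
  apply/existsP; apply: contraNT i0 => /existsPn h.
  apply/eqP/rowP => j; rewrite mxE -(enum_valK j).
  by apply/eqP; rewrite -[_ == _]negbK; exact: h.
move=> t; have := congr1 (fun v : 'rV_T => v ord0 t) hM; rewrite !mxE => h.
rewrite -[RHS]h (reindex_onto enum_val enum_rank)/=; last first.
  by move=> j _; rewrite enum_rankK.
under eq_bigl do rewrite enum_valK eqxx.
by apply: eq_bigr => j _; rewrite enum_valK mxE.
Qed.

(* The witness is a kernel combination over the grid that vanishes at the [T]
   points queried on the zero function: it is then queried at the same points. *)
Lemma regret_lower_bound (C : R) (n T : nat) (pi : algorithm R d) (r eps : R) :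
  0 < C -> (0 < n)%N -> (0 < T)%N -> (T < n ^ d)%N -> 0 < r ->
  (forall b : {ffun 'I_d -> 'I_n} -> R,
    C * \sum_j b j ^+ 2
      <= kernel_form (matern nu rho sigma) (index_enum _) b (@grid_point R d n)) ->
  (forall f, rkhs_ball H ip r f -> simple_regret pi f T <= eps) ->
  r * Num.sqrt (C / (n ^ d)%:R) <= eps.
Proof.
move=> C0 n0 T0 Tn r0 hC hpi; have hH := rkhs_hilbert hk.
pose I : finType := {ffun 'I_d -> 'I_n}.
have cI : #|I| = (n ^ d)%N by rewrite card_ffun !card_ord.
pose xq (t : 'I_T) := query pi (fun=> 0) t.
have [|b [i0 bi0] hb] := @underdetermined_solution I T
  (fun j t => matern nu rho sigma (xq t) (grid_point j)); first by rewrite cI.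
pose f0 x := \sum_(j <- index_enum I) b j * matern nu rho sigma x (grid_point j).
have Hf0 : H f0 by exact: (kernel_sum_rkhs hk).
pose B := \sum_j b j ^+ 2; pose Q := ip f0 f0.
have B0 : 0 < B.
  rewrite /B (bigD1 i0)//= ltr_pwDl ?exprn_even_gt0//.
  by apply: sumr_ge0 => j _; exact: sqr_ge0.
have QE : Q = kernel_form (matern nu rho sigma) (index_enum I) b (@grid_point R d n).
  exact: (ip_kernel_form hk).
have QB : C * B <= Q by rewrite QE; exact: hC.
have Q0 : 0 < Q by apply: lt_le_trans QB; exact: mulr_gt0.
have QS : Q = \sum_j b j * f0 (grid_point j) by exact: (ip_kernel_sum hk).
have [j0 hj0] : exists j0 : I, forall j : I,
    `|f0 (grid_point j)| <= `|f0 (grid_point j0)|.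
  exact: (exists_argmax i0).
have [m mE] : exists m, m = `|f0 (grid_point j0)| by eexists.
have hm (j : I) : `|f0 (grid_point j)| <= m by rewrite mE; exact: hj0.
have N0 : 0 < (n ^ d)%:R :> R by rewrite ltr0n expn_gt0 n0.
have Qm : Q * (C / (n ^ d)%:R) <= m ^+ 2.
  (* AM-GM: [2 b_j f0(y_j) <= C b_j^2 + f0(y_j)^2 / C] *)
  have h : Q <= 2^-1 * (C * B + (n ^ d)%:R * m ^+ 2 / C).
    have -> : (n ^ d)%:R * m ^+ 2 / C = \sum_(j : I) m ^+ 2 / C.
      by rewrite sumr_const cI -[RHS]mulr_natl; ring.
    rewrite /B QS mulrDr !big_distrr/= -big_split/=; apply: ler_sum => j _.
    have hmj : f0 (grid_point j) ^+ 2 <= m ^+ 2.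
      exact: sqr_le_sqr.
    have : 0 <= (C * b j - f0 (grid_point j)) ^+ 2 / C.
      by rewrite divr_ge0 ?sqr_ge0 ?ltW.
    have -> : (C * b j - f0 (grid_point j)) ^+ 2 / C =
        C * b j ^+ 2 - 2 * (b j * f0 (grid_point j)) + f0 (grid_point j) ^+ 2 / C.
      by field; rewrite gt_eqF.
    have : f0 (grid_point j) ^+ 2 / C <= m ^+ 2 / C.
      by rewrite ler_pM2r ?invr_gt0.
    lra.
  have : Q <= (n ^ d)%:R * m ^+ 2 / C by lra.
  by rewrite ler_pdivlMr// mulrA ler_pdivrMr// [in leRHS]mulrC.
(* Sign and scale are chosen so that [f] has norm [r] and takes the value [- (r / Num.sqrt Q * m)]
   at the grid point where [f0] is largest in absolute value. *)
pose sg : R := if 0 <= f0 (grid_point j0) then -1 else 1.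
have sg2 : sg ^+ 2 = 1 by rewrite /sg; case: ifP => _; rewrite ?sqrrN expr1n.
have sgf : sg * f0 (grid_point j0) = - m.
  rewrite /sg mE; case: leP => h; first by rewrite ger0_norm// mulN1r.
  by rewrite ltr0_norm// mul1r opprK.
pose al := sg * (r / Num.sqrt Q).
have sQ : 0 < Num.sqrt Q by rewrite sqrtr_gt0.
pose f x := al * f0 x.
have Hf : H f by exact: (hilbert_scale hH).
have nf : ip_norm ip f = r.
  rewrite /ip_norm (ip_scale hH)// -/Q /al exprMn sg2 mul1r expr_div_n.
  rewrite sqr_sqrtr ?ltW// divfK ?gt_eqF// sqrtr_sqr ger0_norm// ltW//.
have fj0 : - f (grid_point j0) = r / Num.sqrt Q * m.
  by rewrite /f /al mulrAC sgf mulNr opprK mulrC.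
have reg := hpi f (conj Hf _); have {reg} := reg ltac:(by rewrite nf).
apply: le_trans.
apply: le_trans (@simple_regret_ge _ _ pi f T (ip_norm ip f * Num.sqrt (sigma ^+ 2))
   (grid_point j0) _ _ T0 (unit_cube_grid_point _)).
- rewrite fj0 -mulrA ler_pM2l//.
  have -> : m = Num.sqrt (m ^+ 2) by rewrite sqrtr_sqr ger0_norm// mE.
  by rewrite ler_pdivlMl// -sqrtrM; [exact: ler_wsqrtr | exact: ltW].
- by move=> x; exact: rkhs_bounded.
- move=> t tT; rewrite /f /f0.
  by rewrite (hb (Ordinal tT)) mulr0.
Qed.

End lower_bound.

(** * Choice of the parameters and proof of both bounds *)

Lemma powR_le_inv (R : realType) (p X T : R) : 0 < p -> 0 <= X -> 0 <= T ->
  X <= T `^ p -> X `^ p^-1 <= T.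
Proof.
move=> p0 X0 T0 h.
have -> : T = (T `^ p) `^ p^-1 by rewrite -powRrM mulfV ?gt_eqF// powRr1.
apply: ge0_ler_powR => //; rewrite ?nnegrE ?powR_ge0//.
by rewrite invr_ge0 ltW.
Qed.

Lemma exists_pow_gt (R : realType) (d T : nat) : (0 < d)%N -> (0 < T)%N ->
  exists n : nat, [/\ (0 < n)%N, (T < n ^ d)%N &
    n%:R <= 2 * T%:R `^ d%:R^-1 :> R].
Proof.
move=> d0 T0; pose x : R := T%:R `^ d%:R^-1.
have dR : d%:R != 0 :> R by rewrite pnatr_eq0 -lt0n.
have x0 : 0 <= x by exact: powR_ge0.
have xd : x ^+ d = T%:R.
  by rewrite -powR_mulrn// -powRrM mulVf// powRr1.
have x1 : 1 <= x.
  have -> : 1 = 1 `^ d%:R^-1 :> R by rewrite powR1.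
  apply: ge0_ler_powR.
  - by rewrite invr_ge0.
  - by rewrite nnegrE.
  - by rewrite nnegrE.
  - by rewrite ler1n.
exists (Num.truncn x).+1; split => //.
  rewrite -(ltr_nat R) natrX -xd ltrXn2r -?lt0n//.
  exact: truncnS_gt.
have /andP[] := truncn_itv x0; rewrite -/x -natr1; lra.
Qed.

Theorem theorem5p3 (R : realType) (d : nat) (nu rho sigma : R)
  (hd : (0 < d)%N) (hnu : 0 < nu) (hrho : 0 < rho)
  (hsigma : 0 < sigma ^+ 2 <= 1) :
  exists c C eta0 : R, [/\ 0 < c, 0 < C, 0 < eta0 < 1 &
    forall (H : set ('rV[R]_d -> R))
           (ip : ('rV[R]_d -> R) -> ('rV[R]_d -> R) -> R),
    is_rkhs (matern nu rho sigma) H ip ->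
    forall r eps : R, 0 < r -> 0 < eps -> eps / r < eta0 ->
      (forall T : nat, (0 < T)%N ->
         (exists pi : algorithm R d,
            forall f, rkhs_ball H ip r f -> simple_regret pi f T <= eps) ->
         c * (r / eps) `^ (d%:R / (nu + d%:R / 2)) * (ln (r / eps))^-1
           <= T%:R)
      /\
      (exists T : nat, [/\ (0 < T)%N,
         T%:R <= C * (r / eps) `^ (d%:R / nu) &
         exists pi : algorithm R d,
            forall f, rkhs_ball H ip r f -> simple_regret pi f T <= eps])].
Proof.
have /andP[sigma0 _] := hsigma.
have dR : 0 < d%:R :> R by rewrite ltr0n.
pose m := (Num.truncn nu).+1.
have mnu : nu < m%:R by exact: truncnS_gt.
have [A A0 hA] := local_approximation hd hnu hrho sigma0 mnu.
have [L L0 hL] := @matern_form_grid_ge R d nu rho sigma hnu hrho sigma0.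
pose p : R := nu + d%:R / 2.
have p0 : 0 < p by rewrite addr_gt0// divr_gt0.
(* The factor [2]^ p[comes from]n <= 2 * T ^ (1 / d)[, and]Y[is such that]M <= Y * X [^ nu^-1] for
   the number [M] of cells per direction chosen below. *)
pose K : R := Num.sqrt L / 2 `^ p.
have K0 : 0 < K by rewrite divr_gt0 ?sqrtr_gt0 ?powR_gt0.
pose Y : R := (3 * A) `^ nu^-1 + 1.
have Y1 : 1 <= Y by rewrite lerDr powR_ge0.
(* The factor 2 absorbs the final query after the [N] samples; [expR (- 1)] forces
   [ln (r / eps) >= 1]. *)
exists (K `^ (d%:R / p)), (2 * (Y * m%:R) ^+ d), (expR (- 1)).
split.
- exact: powR_gt0.
- by rewrite mulr_gt0// exprn_gt0// mulr_gt0//; lra.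
- by rewrite expR_gt0 expR_lt1 oppr_lt0 ltr01.
move=> H ip hk r eps r0 e0 er.
pose X := r / eps; have X0 : 0 < X by exact: divr_gt0.
have Xe : expR 1 <= X.
  rewrite /X -invf_div -[leLHS]invrK lef_pV2 ?posrE ?divr_gt0 ?invr_gt0
    ?expR_gt0//.
  by rewrite -expRN ltW.
have X1 : 1 <= X by apply: le_trans Xe; have := expR_ge1Dx (1 : R); lra.
rewrite -/X -/p; split.
- move=> T T0 [pi hpi].
  have TR : 0 <= T%:R :> R by [].
  have lnX : 1 <= ln X by rewrite -ler_expR lnK.
  have [n [n0 Tn nT]] := @exists_pow_gt R d T hd T0.
  have nR : 0 < n%:R :> R by rewrite ltr0n.
  have LC : 0 < L * n%:R `^ (- (2 * nu)) by rewrite mulr_gt0 ?powR_gt0.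
  have := regret_lower_bound hk LC n0 T0 Tn r0 (fun b => hL n b n0) hpi.
  have -> : Num.sqrt (L * n%:R `^ (- (2 * nu)) / (n ^ d)%:R)
      = Num.sqrt L * n%:R `^ (- p).
    rewrite -mulrA.
    have -> : n%:R `^ (- (2 * nu)) / (n ^ d)%:R = (n%:R `^ (- p)) ^+ 2 :> R.
      have -> : (n ^ d)%:R = n%:R `^ d%:R :> R by rewrite natrX powR_mulrn// ltW.
      rewrite -[RHS]powR_mulrn ?powR_ge0// -[RHS]powRrM -powRN -powRD.
        by rewrite /p; congr (_ `^ _); field.
      by apply/implyP => _; rewrite gt_eqF.
    by rewrite sqrtrM ?sqrtr_sqr ?ger0_norm ?powR_ge0// ltW.
  move=> h.
  have KX : K * X <= (T%:R `^ d%:R^-1) `^ p.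
    have hn : n%:R `^ p <= 2 `^ p * (T%:R `^ d%:R^-1) `^ p.
      rewrite -powRM ?powR_ge0//; apply: ge0_ler_powR => //; rewrite ?nnegrE.
      - exact: ltW.
      - exact: ltW.
      - by rewrite mulr_ge0 ?powR_ge0.
    have h2 : r * Num.sqrt L <= eps * n%:R `^ p.
      by move: h; rewrite powRN mulrA ler_pdivrMr ?powR_gt0.
    have a0 : 0 < 2 `^ p :> R by rewrite powR_gt0.
    rewrite /K /X; move: (2 `^ p) (T%:R `^ d%:R^-1 `^ p) a0 hn h2 => a t a0 hn h2.
    have -> : Num.sqrt L / a * (r / eps) = r * Num.sqrt L / (a * eps).
      by field; rewrite !gt_eqF.
    rewrite ler_pdivrMr ?mulr_gt0//; apply: le_trans h2 _.
    have -> : t * (a * eps) = eps * (a * t) by ring.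
    by rewrite ler_pM2l.
  have : (K * X) `^ (d%:R / p) <= T%:R.
    have -> : d%:R / p = (p / d%:R)^-1 by rewrite invf_div.
    apply: powR_le_inv => //; first exact: divr_gt0.
      by rewrite mulr_ge0// ltW.
    by apply: le_trans KX _; rewrite -powRrM mulrC.
  rewrite powRM ?(ltW K0) ?(ltW X0)// => hT; apply: le_trans hT.
  rewrite ler_piMr//; first by rewrite mulr_ge0 ?powR_ge0.
  by rewrite invf_le1// (lt_le_trans _ lnX).
(* Large enough for the approximation error to be at most [eps / 3], as [approx_algorithm] loses a
   factor 3. *)
pose M := (Num.truncn ((3 * A * X) `^ nu^-1)).+1.
have M0 : (0 < M)%N by [].
have MR : 0 < M%:R :> R by rewrite ltr0n.
have AM : A * M%:R `^ (- nu) * r <= eps / 3.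
  have h : 3 * A * X <= M%:R `^ nu.
    have AX0 : 0 <= 3 * A * X by rewrite mulr_ge0 ?(ltW X0)// mulr_ge0 ?(ltW A0).
    have -> : 3 * A * X = ((3 * A * X) `^ nu^-1) `^ nu.
      by rewrite -powRrM mulVf ?gt_eqF// powRr1.
    apply: ge0_ler_powR; rewrite ?nnegrE ?powR_ge0//; apply: ltW => //.
    exact: truncnS_gt.
  rewrite powRN mulrAC ler_pdivrMr ?powR_gt0//.
  move: h; rewrite /X; set Z := _ `^ _.
  by rewrite mulrA ler_pdivrMr//; lra.
have MX : M%:R <= Y * X `^ nu^-1.
  have AX0 : 0 <= (3 * A * X) `^ nu^-1 by exact: powR_ge0.
  have /andP[h _] := truncn_itv AX0.
  have X1' : 1 <= X `^ nu^-1.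
    have -> : 1 = 1 `^ nu^-1 :> R by rewrite powR1.
    apply: ge0_ler_powR; rewrite ?nnegrE ?invr_ge0//; exact: ltW.
  rewrite /M -natr1 /Y [leRHS]mulrDl [X in _ <= _ + X]mul1r; apply: lerD => //.
  by apply: le_trans h _; rewrite powRM ?(ltW X0)// mulr_ge0 ?(ltW A0).
(* All nodes of all cells: in each direction, a cell and a place inside it. *)
pose I : finType := {ffun 'I_d -> 'I_M * 'I_m}.
pose N := #|I|.
have NE : N = ((M * m) ^ d)%N by rewrite /N card_ffun card_prod !card_ord.
have N0 : (0 < N)%N by rewrite NE expn_gt0 muln_gt0 M0.
exists N.+1; split => //.
  have N1 : 1 <= N%:R :> R by rewrite ler1n.
  have NX : N%:R <= (Y * m%:R) ^+ d * X `^ (d%:R / nu).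
    have -> : X `^ (d%:R / nu) = (X `^ nu^-1) ^+ d.
      by rewrite -powR_mulrn ?powR_ge0// -powRrM mulrC.
    rewrite NE natrX natrM -exprMn; apply: lerXn2r; rewrite ?nnegrE.
    - by rewrite mulr_ge0.
    - by rewrite mulr_ge0 ?powR_ge0// mulr_ge0//; lra.
    - by rewrite mulrAC ler_wpM2r.
  rewrite -natr1 -mulrA; lra.
pose pt (q : I) : 'rV[R]_d :=
  node (fun k => (q k).1) [ffun k => (q k).2].
have ptc q : unit_cube (pt q) by exact: unit_cube_node.
pose pts (i : 'I_N) : cube_point R d := Sub (pt (enum_val i)) (ptc _).
have /choice [w hw] : forall x : cube_point R d, exists w : 'I_N -> R,
    forall f, H f -> `|f (val x) - \sum_(i < N) w i * f (val (pts i))|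
      <= A * M%:R `^ (- nu) * ip_norm ip f.
  move=> x; have [c [w hw]] := hA H ip hk M (val x) M0 (valP x).
  pose idx (j : {ffun 'I_d -> 'I_m}) : 'I_N :=
    enum_rank ([ffun k => (c k, j k)] : I).
  have ptE j : pt (enum_val (idx j)) = node c j.
    by rewrite enum_rankK; apply/rowP => k; rewrite !mxE !ffunE.
  (* The weights of the cell containing [x], extended by zero to all [N] nodes. *)
  exists (fun i => \sum_(j | idx j == i) w j) => f Hf.
  have -> : \sum_(i < N) (\sum_(j | idx j == i) w j) * f (val (pts i))
      = \sum_j w j * f (node c j).
    rewrite [RHS](partition_big idx predT)//=; apply: eq_bigr => i _.
    rewrite big_distrl/=; apply: eq_bigr => j /eqP <-.
    by rewrite ptE.
  exact: hw.
have [||||pi hpi] := @approx_algorithm R d (rkhs_ball H ip r) N pts w (eps / 3).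
- by rewrite divr_gt0.
- by constructor; exact: (pts (Ordinal N0)).
- move=> f [Hf _]; exists (ip_norm ip f * Num.sqrt (sigma ^+ 2)) => x.
  exact: (rkhs_bounded hk).
- move=> f [Hf fr] x; apply: le_trans (hw x f Hf) _; apply: le_trans AM.
  by rewrite ler_wpM2l// mulr_ge0 ?powR_ge0// ltW.
exists pi => f Sf; apply: le_trans (hpi f Sf) _.
by rewrite mulrCA mulfV ?mulr1.
Qed.
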